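(* Let $X$ be a topologically mixing (one-sided) topological Markov shift with shift map $T$ and let $\phi:X\to\mathbb R$ satisfy the Walters condition. If $\sup\phi<\infty$, then $$P_G(\phi)=\sup\Big\{h_\mu(T)+\int\phi\,d\mu\Big\},$$ where the supremum ranges over the shift invariant Borel probability measures $\mu$ on $X$ for which $h_\mu(T)+\int\phi\,d\mu$ is well defined (i.e. not of the form $\infty-\infty$).
   Context: One-sided topological Markov shift (TMS): let $S$ be a finite or countable alphabet and $A=(A_{ab})_{a,b\in S}$ a $\{0,1\}$-matrix; $X=\{x\in S^{\mathbb N}:A_{x_ix_{i+1}}=1\ \forall i\ge0\}$ (indices start at $0$), $T(x_0,x_1,\dots)=(x_1,x_2,\dots)$, with the product topology induced by the discrete topology on $S$. Cylinders: $[a_0,\dots,a_n]=\{x\in X:x_0=a_0,\dots,x_n=a_n\}$. Topologically mixing: for every two states $a,b$ there is $N_{ab}$ such that for all $n\ge N_{ab}$ there exist states $\xi_1,\dots,\xi_{n-1}$ with $A_{a\xi_1}A_{\xi_1\xi_2}\cdots A_{\xi_{n-1}b}=1$. Write $\phi_n=\sum_{i=0}^{n-1}\phi\circ T^i$ and $\mathrm{var}_n g=\sup\{|g(x)-g(y)|:x_i=y_i\ \forall\,0\le i\le n-1\}$. Walters condition: $\phi$ is continuous, $\lim_{k\to\infty}\sup_{n\ge1}\mathrm{var}_{n+k}\phi_n=0$ and $\mathrm{var}_{n+k}\phi_n<\infty$ for all $k,n\ge1$. Gurevich pressure: $P_G(\phi)=\lim_{n\to\infty}\frac1n\log Z_n(\phi,a)$,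 where $Z_n(\phi,a)=\sum_{T^nx=x}e^{\phi_n(x)}1_{[a]}(x)$ and $a\in S$; for $X$ topologically mixing and $\phi$ Walters the limit exists (possibly $+\infty$) and is independent of $a$. $h_\mu(T)$ denotes Kolmogorov–Sinai entropy. *)

(* Defs.v *)
From HB Require Import structures.
From mathcomp Require Import all_boot all_order all_algebra.
From mathcomp Require Import all_classical all_reals all_analysis.

Set Implicit Arguments.
Unset Strict Implicit.
Unset Printing Implicit Defensive.

Import Order.TTheory GRing.Theory Num.Theory.
Import numFieldNormedType.Exports.

Local Open Scope classical_set_scope.
Local Open Scope ring_scope.

(** * Topological Markov shifts *)

(* The {0,1}-matrix (A_{ab}) is the boolean relation A; a countType is finite or
   countably infinite. *)
Definition tms_set (S : countType) (A : rel S) :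
    set (prod_topology (fun _ : nat => discrete_topology S)) :=
  [set x | forall i, A (x i) (x i.+1)].

(* As a set_type, X carries the subspace topology. *)
Definition tms (S : countType) (A : rel S) := set_type (tms_set A).

Definition tms_coord (S : countType) (A : rel S) (x : tms A) (i : nat) : S :=
  set_val x i.

Lemma tms_shift_subproof (S : countType) (A : rel S) (x : tms A) :
  (fun i => tms_coord x i.+1) \in tms_set A.
Proof. by apply/mem_set => i; exact: (set_valP x). Qed.

Definition tms_shift (S : countType) (A : rel S) (x : tms A) : tms A :=
  exist (fun y => y \in tms_set A) _ (tms_shift_subproof x).

(* The path a -> xi_1 -> ... -> xi_n -> b has n.+1 edges. *)
Definition topologically_mixing (S : countType) (A : rel S) :=
  forall a b : S, exists N : nat, forall n : nat, (N <= n.+1)%N ->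
    exists xi : n.-tuple S, path A a (rcons xi b).

(** * Potentials *)

Definition birkhoff (R : realType) (T : Type) (f : T -> T) (phi : T -> R)
    (n : nat) (x : T) : R :=
  \sum_(i < n) phi (iter i f x).

Definition tms_var (R : realType) (S : countType) (A : rel S) (n : nat)
    (g : tms A -> R) : \bar R :=
  ereal_sup [set `|g z.1 - g z.2|%:E | z in
    [set z : tms A * tms A |
      forall i, (i < n)%N -> tms_coord z.1 i = tms_coord z.2 i]].

Definition walters (R : realType) (S : countType) (A : rel S)
    (phi : tms A -> R) :=
  [/\ continuous phi,
      (fun k : nat => ereal_sup
        [set tms_var (n + k) (birkhoff (@tms_shift S A) phi n)
          | n in [set n : nat | (1 <= n)%N]]) @ \oo --> 0%E
    & forall k n : nat, (1 <= k)%N -> (1 <= n)%N ->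
        (tms_var (n + k) (birkhoff (@tms_shift S A) phi n) < +oo)%E].

(* Z_n may be infinite, and it may vanish for small n, in which case
   lne 0 = -oo. *)
Definition partition_function (R : realType) (S : countType) (A : rel S)
    (phi : tms A -> R) (a : S) (n : nat) : \bar R :=
  \esum_(x in [set x : tms A | iter n (@tms_shift S A) x = x /\ tms_coord x 0 = a])
    (expR (birkhoff (@tms_shift S A) phi n x))%:E.

Definition gurevich_pressure (R : realType) (S : countType) (A : rel S)
    (phi : tms A -> R) (a : S) : \bar R :=
  limn (fun n => n%:R^-1%:E * lne (partition_function phi a n))%E.

(** * Kolmogorov-Sinai entropy *)

Section entropy.
Context (R : realType) (d : measure_display) (T : measurableType d).
Variables (mu : probability T R) (f : T -> T).

(* Empty pieces are allowed; they contribute nothing to the entropy. *)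
Definition measurable_partition (I : finType) (P : I -> set T) :=
  [/\ forall i, measurable (P i), trivIset setT P
    & \bigcup_(i in setT) P i = setT].

(* 0 * ln 0 = 0 here. *)
Definition partition_entropy (I : finType) (P : I -> set T) : R :=
  - \sum_(i : I) fine (mu (P i)) * ln (fine (mu (P i))).

(* The join of P, f^-1 P, ..., f^-(n-1) P, indexed by words of length n. *)
Definition iterated_join (I : finType) (P : I -> set T) (n : nat)
    (w : {ffun 'I_n -> I}) : set T :=
  \bigcap_(j in [set: 'I_n]) (iter j f @^-1` P (w j)).

Definition entropy_wrt (I : finType) (P : I -> set T) : R :=
  limn (fun n => n%:R^-1 * partition_entropy (@iterated_join I P n)).

Definition ks_entropy : \bar R :=
  ereal_sup [set h | exists (k : nat) (P : 'I_k -> set T),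
    measurable_partition P /\ h = (entropy_wrt P)%:E].

Definition measure_invariant :=
  forall B : set T, measurable B -> mu (f @^-1` B) = mu B.

End entropy.

(** * The variational quantity *)

(* Measurable types are pointed, so the Borel sigma-algebra is put on an alias
   of X that records a base point; the base point plays no other role. *)
Definition based (X : Type) (x0 : X) : Type := X.
HB.instance Definition _ (X : topologicalType) (x0 : X) :=
  Topological.copy (based x0) X.
HB.instance Definition _ (X : topologicalType) (x0 : X) :=
  isPointed.Build (based x0) x0.

Definition borel (X : topologicalType) (x0 : X) :=
  g_sigma_algebraType (@open (based x0)).

(* Quantifying existentially over the base point loses nothing: an empty space
   has no probability measure. *)
Definition free_energies (R : realType) (S : countType) (A : rel S)
    (phi : tms A -> R) : set (\bar R) :=
  [set e | exists (x0 : tms A) (mu : probability (borel x0) R),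
    let h := ks_entropy mu (@tms_shift S A) in
    let I := (\int[mu]_x (phi x)%:E)%E in
    [/\ measure_invariant mu (@tms_shift S A), (h +? I)%E & e = (h + I)%E]].

(* Main.v *)
Require Import Defs.
From HB Require Import structures.
From mathcomp Require Import all_boot all_order all_algebra.
From mathcomp Require Import all_classical all_reals all_analysis.
From mathcomp Require Import measurable_realfun lra ring zify.

(* Only bounded distortion is used of the Walters condition: points that agree on
   coordinates 0, ..., n have Birkhoff sums phi_n at distance at most C. Hence
   Z_n(a) Z_m(a) <= e^(2C) Z_(n+m)(a), and by Fekete's lemma P_G is the supremum
   of (log Z_n(a) - 2C) / n over n >= 1.

   P_G <= sup: if nc + 2C < log Z_n(a), finitely many loops w at a of length n already
   have sum of e^(phi_n(w)) > e^(nc + 2C). Concatenate them independently, each with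
   probability proportional to e^(phi_n(w)), and average over one period: the
   resulting invariant measure has entropy plus integral at least c.

   P_G >= sup: for a finite partition Q, approximate Q up to small measure by a
   function rho of the window x_0, ..., x_(m-1), where all states outside a finite set
   are lumped into one letter. Gibbs' inequality for the join of the n-names of Q and
   of the lumped words c of length L = n + m, with the weights
     W(c) * prod_(t < n) kappa(q_t | rho_t(c)),
   kappa(. | r) being the point mass at r perturbed by a small uniform noise, bounds
   H(Q^n) + L * int phi by log sum W(c) up to errors of small order. Here W(c) is
   e^(phi_(j-i)(T^i x_c) + (L - (j-i)) P_G), i and j being the first and the last time at
   which c is not the lumped letter; closing the paths x_i ... x_j up through a gives
   sum W(c) <= (L^2 + 1) e^(K + L P_G). *)

Set Implicit Arguments.
Unset Strict Implicit.
Unset Printing Implicit Defensive.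

Import Order.TTheory GRing.Theory Num.Theory.
Import numFieldNormedType.Exports.

Local Open Scope classical_set_scope.
Local Open Scope ring_scope.

(** * Gibbs' inequality and laws of finite-valued maps *)

Section shannon.
Context {R : realType}.

Definition shannon (I : finType) (p : I -> R) : R := - \sum_i p i * ln (p i).

(** This is ln (1 + t) <= t at t = q / p - 1. As [ln 0] is 0, the case p = 0 reduces to 0 <= q; the
    last hypothesis excludes q = 0 < p, where the inequality can fail. *)
Lemma gibbs_term (p q : R) : 0 <= p -> 0 <= q -> (p != 0 -> q != 0) ->
  p * ln q - p * ln p <= q - p.
Proof.
move=> p0 q0 pq; have [->|pN0] := eqVneq p 0; first by rewrite !mul0r !subr0.
have pP : 0 < p by rewrite lt_neqAle eq_sym pN0.
have qP : 0 < q by rewrite lt_neqAle eq_sym pq.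
have -> : q - p = p * (q / p - 1).
  by rewrite mulrBr mulr1 mulrCA divff // mulr1.
rewrite -mulrBr ler_wpM2l //.
have qpP : 0 < q / p by rewrite divr_gt0.
have -> : ln q - ln p = ln (1 + (q / p - 1)) by rewrite addrCA subrr addr0 ln_div.
by apply: le_ln1Dx; rewrite ltrBrDr addrC subrr.
Qed.

Lemma gibbs (I : finType) (p q : I -> R) :
  (forall i, 0 <= p i) -> (forall i, 0 <= q i) ->
  (forall i, p i != 0 -> q i != 0) -> \sum_i q i <= \sum_i p i ->
  shannon p <= - \sum_i p i * ln (q i).
Proof.
move=> p0 q0 pq spq; rewrite lerN2 -subr_le0 -sumrB.
apply: (@le_trans _ _ (\sum_i (q i - p i))).
  by apply: ler_sum => i _; apply: gibbs_term => //; exact: pq.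
by rewrite sumrB subr_le0.
Qed.

(** The finite variational principle: Gibbs' inequality against the normalised weights W / Z. *)
Lemma shannon_weight (I : finType) (p W : I -> R) :
  (forall i, 0 <= p i) -> \sum_i p i = 1 -> (forall i, 0 <= W i) ->
  (forall i, p i != 0 -> W i != 0) ->
  shannon p + \sum_i p i * ln (W i) <= ln (\sum_i W i).
Proof.
move=> p0 p1 W0 pW; set Z := \sum_i W i.
have Z0 : 0 < Z.
  rewrite lt_neqAle sumr_ge0 // andbT eq_sym.
  apply/eqP => /psumr_eq0P WZ; have : \sum_i p i = 0.
    apply: big1 => i _; apply/eqP; apply: contraT => /pW.
    by rewrite WZ ?eqxx // => j _.
  by rewrite p1 => /eqP; rewrite oner_eq0.
have q0 i : 0 <= W i / Z by rewrite divr_ge0 // ltW.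
have := @gibbs I p (fun i => W i / Z) p0 q0.
have h i : p i != 0 -> W i / Z != 0.
  by move=> /pW Wi; rewrite mulf_neq0 // invr_eq0 gt_eqF.
rewrite -mulr_suml divff ?gt_eqF // p1 => /(_ h (lexx _)) le.
rewrite -lerBrDr; apply: (le_trans le).
have -> : \sum_i p i * ln (W i / Z) = \sum_i (p i * ln (W i) - p i * ln Z).
  apply: eq_bigr => i _; have [->|pi0] := eqVneq (p i) 0; first by rewrite !mul0r subr0.
  rewrite ln_div ?posrE // ?mulrBr // lt_neqAle W0 eq_sym pW //.
by rewrite sumrB -mulr_suml p1 mul1r opprB.
Qed.

Lemma shannon_ge0 (I : finType) (p : I -> R) :
  (forall i, 0 <= p i) -> \sum_i p i = 1 -> 0 <= shannon p.
Proof.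
move=> p0 p1; rewrite /shannon -sumrN; apply: sumr_ge0 => i _.
rewrite -mulrN mulr_ge0 // oppr_ge0 ln_le0 // -p1 (bigD1 i) //= lerDl.
by apply: sumr_ge0.
Qed.

(** [shannon q] is the average over k of the cross entropies of [p k] relative to [q], and Gibbs'
    inequality bounds each of them from below. *)
Lemma shannon_concave (I : finType) (n : nat) (p : 'I_n -> I -> R) (q : I -> R) :
  (forall k i, 0 <= p k i) -> (forall k, \sum_i p k i = 1) -> (0 < n)%N ->
  (forall i, q i = n%:R^-1 * \sum_k p k i) ->
  n%:R^-1 * \sum_k shannon (p k) <= shannon q.
Proof.
move=> p0 p1 n0 qE; have nR : 0 < n%:R :> R by rewrite ltr0n.
have q0 i : 0 <= q i.
  by rewrite qE mulr_ge0 ?invr_ge0 ?ler0n // sumr_ge0.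
have q1 : \sum_i q i = 1.
  under eq_bigr do rewrite qE.
  rewrite -mulr_sumr exchange_big /=; under eq_bigr do rewrite p1.
  by rewrite sumr_const card_ord -[1 *+ n]/(n%:R) mulVf // gt_eqF.
have -> : shannon q = n%:R^-1 * \sum_k (- \sum_i p k i * ln (q i)).
  rewrite /shannon sumrN mulrN; congr (- _).
  rewrite exchange_big /= mulr_sumr; apply: eq_bigr => i _.
  by rewrite -mulr_suml mulrA -qE.
rewrite ler_wpM2l ?invr_ge0 ?ler0n //; apply: ler_sum => k _.
apply: gibbs => //; last by rewrite p1 q1.
move=> i pki; rewrite qE mulf_neq0 ?invr_eq0 ?gt_eqF //.
rewrite lt_neqAle sumr_ge0 // andbT eq_sym psumr_eq0 //.
by apply/allPn; exists k; rewrite ?mem_index_enum.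
Qed.

End shannon.

Section law.
Context {R : realType} {d : measure_display} {T : measurableType d}.
Implicit Types (mu : probability T R).

(** Measurability is stated fibre by fibre, so that the finite type J carries no sigma-algebra. *)
Definition fmeas (J : finType) (Y : T -> J) :=
  forall j, measurable (Y @^-1` [set j]).

Definition law mu (J : finType) (Y : T -> J) (j : J) : R :=
  fine (mu (Y @^-1` [set j])).

Lemma fmeas_pre (J : finType) (Y : T -> J) (E : set J) :
  fmeas Y -> measurable (Y @^-1` E).
Proof.
move=> mY; have -> : Y @^-1` E = \bigcup_(j in E) (Y @^-1` [set j]).
  apply/seteqP; split => [x Ex|x [j Ej /= ->]] //; by exists (Y x).
by apply: fin_bigcup_measurable => //; exact: finite_finset.
Qed.

Lemma fmeas_comp (J K : finType) (Y : T -> J) (g : J -> K) :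
  fmeas Y -> fmeas (g \o Y).
Proof. by move=> mY k; apply: (@fmeas_pre _ Y (g @^-1` [set k])). Qed.

Lemma fmeas_pair (J K : finType) (Y : T -> J) (Z : T -> K) :
  fmeas Y -> fmeas Z -> fmeas (fun x => (Y x, Z x)).
Proof.
move=> mY mZ [j k].
have -> : (fun x => (Y x, Z x)) @^-1` [set (j, k)] =
    Y @^-1` [set j] `&` Z @^-1` [set k].
  by apply/seteqP; split => x /= [-> ->].
exact: measurableI.
Qed.

Lemma fmeas_ffun (I J : finType) (Y : I -> T -> J) :
  (forall i, fmeas (Y i)) -> fmeas (fun x => [ffun i => Y i x]).
Proof.
move=> mY w.
have -> : (fun x => [ffun i => Y i x]) @^-1` [set w] =
    \bigcap_(i in [set: I]) (Y i @^-1` [set w i]).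
  apply/seteqP; split => x /=.
    by move=> <- i _ /=; rewrite ffunE.
  by move=> h; apply/ffunP => i; rewrite ffunE; exact: (h i).
by apply: fin_bigcap_measurable => [|i _]; [exact: finite_finset|exact: mY].
Qed.

Lemma law_ge0 mu (J : finType) (Y : T -> J) j : 0 <= law mu Y j.
Proof. by rewrite fine_ge0. Qed.

Lemma prob_fineK mu (B : set T) : measurable B -> ((fine (mu B))%:E = mu B)%E.
Proof. by move=> mB; rewrite fineK // fin_num_measure. Qed.

Lemma law_comp mu (J K : finType) (Y : T -> J) (g : J -> K) (k : K) :
  fmeas Y -> law mu (g \o Y) k = \sum_(j | g j == k) law mu Y j.
Proof.
move=> mY; apply: EFin_inj; rewrite prob_fineK; last exact: fmeas_comp.
rewrite -sumEFin; under eq_bigr do rewrite prob_fineK //.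
rewrite (@bigfs _ _ _ _ _ (fun j => g j == k)) ?index_enum_uniq //; last first.
  by move=> j _; rewrite mem_index_enum.
rewrite -measure_fin_bigcup //=.
- congr (mu _); apply/seteqP; split => x /=.
    by move=> gk; exists (Y x) => //=; exact/eqP.
  by move=> [j /= /eqP <- <-].
- by move=> i j _ _ [x [/= <- <-]].
Qed.

Lemma law_sum mu (J : finType) (Y : T -> J) : fmeas Y -> \sum_j law mu Y j = 1.
Proof.
move=> mY; have := @law_comp mu J unit Y (fun=> tt) tt mY.
rewrite /law (_ : _ @^-1` _ = setT); last by apply/seteqP; split.
by rewrite probability_setT /= => <-.
Qed.

Lemma mean_comp mu (J K : finType) (Y : T -> J) (h : J -> K) (g : K -> R) :
  fmeas Y -> \sum_k law mu (h \o Y) k * g k = \sum_j law mu Y j * g (h j).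
Proof.
move=> mY; rewrite [RHS](partition_big h predT) //=; apply: eq_bigr => k _.
rewrite law_comp // mulr_suml; apply: eq_bigr => j /eqP <- //.
Qed.

Lemma mean_setE mu (J : finType) (Y : T -> J) (E : pred J) :
  fmeas Y -> \sum_j law mu Y j * (E j)%:R = fine (mu (Y @^-1` [set j | E j])).
Proof.
move=> mY; have := @law_comp mu J bool Y E true mY.
rewrite {1}/law => h.
have -> : Y @^-1` [set j | E j] = (E \o Y) @^-1` [set true] by [].
rewrite h [RHS]big_mkcond /=; apply: eq_bigr => j _.
by case: (E j); rewrite ?mulr1 ?mulr0.
Qed.

Lemma measurable_fin_comp (J : finType) (Y : T -> J) (g : J -> R) :
  fmeas Y -> measurable_fun setT (fun x => g (Y x)).
Proof.
move=> mY _ B mB; rewrite setTI.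
exact: (@fmeas_pre _ Y (g @^-1` B)).
Qed.

Lemma integral_fin mu (J : finType) (Y : T -> J) (g : J -> R) : fmeas Y ->
  (\int[mu]_x (g (Y x))%:E = (\sum_j law mu Y j * g j)%:E)%E.
Proof.
move=> mY.
have gE x : (g (Y x))%:E =
   (\sum_(j <- index_enum J) (g j)%:E * (\1_(Y @^-1` [set j]) x)%:E)%E.
  rewrite (bigD1 (Y x)) //= indicE mem_set // mule1 big1 ?adde0 // => j jx.
  rewrite indicE memNset ?mule0 // => /= h; by rewrite h eqxx in jx.
have intind j : mu.-integrable setT (EFin \o \1_(Y @^-1` [set j])).
  by apply: integrable_indic; exact: mY.
under eq_integral do rewrite gE.
rewrite integral_sum //; last first.
  by move=> j; apply: integrableZl => //; exact: intind.
rewrite -sumEFin; apply: eq_bigr => j _.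
rewrite integralZl //=; last exact: intind.
by rewrite integral_indic // setIT EFinM prob_fineK // muleC.
Qed.

Lemma integrable_fin mu (J : finType) (Y : T -> J) (g : J -> R) : fmeas Y ->
  mu.-integrable setT (fun x => (g (Y x))%:E).
Proof.
move=> mY; apply/integrableP; split.
  by apply/measurable_EFinP; exact: measurable_fin_comp.
under eq_integral do rewrite abse_EFin.
by rewrite (integral_fin mu (fun j => `|g j|)) // ltry.
Qed.

End law.

(** * Fekete's lemma *)

Section fekete.
Context {R : realType}.
Local Open Scope ereal_scope.

Lemma lt_EFin_dense (c : R) (x : \bar R) : c%:E < x ->
  exists2 a : R, (c < a)%R & a%:E < x.
Proof.
case: x => [x||] //; first by rewrite lte_fin => /midf_lt[] *; exists ((c + x) / 2)%R;
  rewrite ?lte_fin.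
by move=> _; exists (c + 1)%R; rewrite ?ltry // ltrDl.
Qed.

Lemma gtNy_EFin (x : \bar R) : -oo < x -> exists b : R, b%:E < x.
Proof.
case: x => [x||] // _; last by exists 0%R; rewrite ltry.
by exists (x - 1)%R; rewrite lte_fin ltrBlDr ltrDl.
Qed.

(** Testing from below with reals c < S treats a finite limit and the limit +oo alike. *)
Lemma cvge_sandwich (x : nat -> \bar R) (S : \bar R) : -oo < S ->
  (\forall n \near \oo, x n <= S) ->
  (forall c : R, c%:E < S -> \forall n \near \oo, c%:E <= x n) ->
  x @ \oo --> S.
Proof.
move=> SN xS Sx; case: S SN xS Sx => [s| |] // _ xS Sx; last first.
  by apply/cvgeyPge => A; apply: Sx; rewrite ltry.
apply/fine_cvgP; split.
  have : (s - 1)%:E < s%:E by rewrite lte_fin ltrBlDr ltrDl.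
  move=> /Sx; move: xS; apply: filterS2 => n.
  by case: (x n).
apply/cvgrPdist_le => e e0.
have : (s - e)%:E < s%:E by rewrite lte_fin ltrBlDr ltrDl.
move=> /Sx; move: xS; apply: filterS2 => n /=.
case: (x n) => //= r; rewrite !lee_fin => h1 h2.
by rewrite ger0_norm ?subr_ge0 //; lra.
Qed.

(* Superadditivity is stated through strict lower real bounds, which avoids
   sums of infinities of opposite signs. *)
Lemma fekete (a : nat -> \bar R) (N : nat) :
  (forall n m (b c : R), (0 < n)%N -> (0 < m)%N ->
     b%:E < a n -> c%:E < a m -> (b + c)%:E < a (n + m)%N) ->
  (forall n, (N <= n)%N -> -oo < a n) ->
  (fun n => n%:R^-1%:E * a n) @ \oo -->
    ereal_sup [set n%:R^-1%:E * a n | n in [set n | (0 < n)%N]].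
Proof.
move=> sup aN; apply: cvge_sandwich.
- apply: (@lt_le_trans _ _ (N.+1%:R^-1%:E * a N.+1)); last first.
    by apply: ereal_sup_ubound; exists N.+1.
  have := aN N.+1 (leqnSn _); case: (a _) => [r||] // _.
    by rewrite -EFinM ltNyr.
  by rewrite gt0_muley // lte_fin invr_gt0 ltr0n.
- exists 1%N => // n /= n0; apply: ereal_sup_ubound; by exists n.
move=> c /ereal_sup_gt[_ [m /= m0 <-] cm].
have mR : (0 < m%:R :> R)%R by rewrite ltr0n.
have {}cm : (m%:R * c)%:E < a m.
  rewrite EFinM -(@lte_pdivlMl _ m%:R) //.
have [al cal alm] := lt_EFin_dense cm.
(* b bounds [a] from below on m consecutive indices, one for each remainder modulo m. They start
   beyond N, because [a] may be -oo at smaller indices. *)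
have [b hb] : exists b : R, forall r, (N.+1 <= r < N.+1 + m)%N -> b%:E < a r.
  elim: (m) => [|k [b hb]].
    by exists 0%R => r; rewrite addn0 => /andP[h1 h2]; move: (leq_trans h2 h1); rewrite ltnn.
  have [b' hb'] := gtNy_EFin (aN (N.+1 + k)%N (leq_trans (leqnSn _) (leq_addr _ _))).
  exists (Num.min b b') => r /andP[r1]; rewrite addnS ltnS leq_eqVlt => /orP[/eqP->|r2].
    by apply: le_lt_trans hb'; rewrite lee_fin ge_min lexx orbT.
  by apply: le_lt_trans (hb r _); rewrite ?lee_fin ?ge_min ?lexx // r1.
have key q r : (N.+1 <= r < N.+1 + m)%N -> (q%:R * al + b)%:E < a (q * m + r)%N.
  move=> hr; elim: q => [|q IH]; first by rewrite mul0r add0r mul0n add0n; exact: hb.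
  rewrite mulSn -addnA -[in X in X%:R]add1n natrD mulrDl mul1r -addrA.
  apply: sup => //; move/andP: hr => [h1 _].
  by rewrite addn_gt0 (leq_trans _ h1) // orbT.
(* Each of the q blocks of length m gains al - m c > 0 over the target; after q0 blocks the gain is
   at least D, which covers b and the contribution r c of the remainder. *)
pose D := (`|b| + (N.+1 + m)%:R * `|c|)%R.
pose q0 := Num.bound (D / (al - m%:R * c))%R.
exists (N.+1 + m * q0)%N => // n /= hn.
pose q := ((n - N.+1) %/ m)%N; pose r := (N.+1 + (n - N.+1) %% m)%N.
have hr : (N.+1 <= r < N.+1 + m)%N by rewrite /r leq_addr ltn_add2l ltn_mod.
have nE : n = (q * m + r)%N.
  rewrite /q /r addnCA -divn_eq subnKC //.
  by apply: leq_trans hn; rewrite leq_addr.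
have hq : (q0 <= q)%N.
  by rewrite /q leq_divRL // mulnC leq_subRL // (leq_trans _ hn) // leq_addr.
have n0 : (0 < n)%N by apply: leq_trans hn; rewrite addSn.
rewrite lee_pdivlMl ?ltr0n //.
have kk := ltW (key q r hr); rewrite -nE in kk; apply: le_trans kk.
rewrite lee_fin.
have dpos : (0 < al - m%:R * c)%R by rewrite subr_gt0.
have hD : (D <= q%:R * (al - m%:R * c))%R.
  rewrite -ler_pdivrMr //; apply: (@le_trans _ _ q0%:R)%R.
    exact/ltW/unstable.ltr_bound.
  by rewrite ler_nat.
rewrite [in X in (X%:R)%R]nE natrD natrM.
have hrc : (r%:R * c <= (N.+1 + m)%:R * `|c|)%R.
  apply: (@le_trans _ _ (r%:R * `|c|)%R).
    by rewrite ler_wpM2l // ler_norm.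
  by rewrite ler_wpM2r // ler_nat ltnW //; case/andP: hr.
have hb' : (- b <= `|b|)%R by rewrite -normrN ler_norm.
rewrite /D in hD; nra.
Qed.
End fekete.

(** * Entropy of finite-valued processes *)

Definition process (T : Type) (J : finType) (f : T -> T) (Y : T -> J) (n : nat)
    (x : T) : {ffun 'I_n -> J} :=
  [ffun j : 'I_n => Y (iter j f x)].

Section entropy_rv.
Context {R : realType} {d : measure_display} {T : measurableType d}.
Variable mu : probability T R.

Notation H Y := (shannon (law mu Y)).

Lemma shannon_law_ge0 (J : finType) (Y : T -> J) : fmeas Y -> 0 <= H Y.
Proof.
by move=> mY; apply: shannon_ge0; [exact: law_ge0|exact: law_sum].
Qed.

Lemma law_le_comp (J K : finType) (Y : T -> J) (g : J -> K) j :
  fmeas Y -> law mu Y j <= law mu (g \o Y) (g j).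
Proof.
move=> mY; rewrite law_comp // (bigD1 j) //= lerDl.
by apply: sumr_ge0 => *; exact: law_ge0.
Qed.

Lemma shannon_comp (J K : finType) (Y : T -> J) (g : J -> K) :
  fmeas Y -> H (g \o Y) <= H Y.
Proof.
move=> mY; rewrite /shannon lerN2 mean_comp //; apply: ler_sum => j _.
have [->|j0] := eqVneq (law mu Y j) 0; first by rewrite !mul0r.
have jp : 0 < law mu Y j by rewrite lt_neqAle eq_sym j0 law_ge0.
rewrite ler_wpM2l ?law_ge0 // ler_ln ?posrE //; first exact: law_le_comp.
by apply: lt_le_trans jp _; exact: law_le_comp.
Qed.

(** Gibbs' inequality with the product of the two marginal laws as comparison law. *)
Lemma shannon_pair (J K : finType) (Y : T -> J) (Z : T -> K) :
  fmeas Y -> fmeas Z -> H (fun x => (Y x, Z x)) <= H Y + H Z.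
Proof.
move=> mY mZ; set YZ := fun x => _; have mYZ : fmeas YZ by exact: fmeas_pair.
have Yle j : law mu YZ j <= law mu Y j.1 by exact: (law_le_comp fst j mYZ).
have Zle j : law mu YZ j <= law mu Z j.2 by exact: (law_le_comp snd j mYZ).
have pos j : law mu YZ j != 0 -> 0 < law mu Y j.1 /\ 0 < law mu Z j.2.
  move=> j0; have jp : 0 < law mu YZ j by rewrite lt_neqAle eq_sym j0 law_ge0.
  by split; apply: lt_le_trans jp _.
apply: (@le_trans _ _ (- \sum_j law mu YZ j * ln (law mu Y j.1 * law mu Z j.2))).
  apply: gibbs.
  - by move=> i; exact: law_ge0.
  - by move=> i; rewrite mulr_ge0 ?law_ge0.
  - by move=> j /pos[h1 h2]; rewrite gt_eqF // mulr_gt0.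
  - rewrite (law_sum mu mYZ) -(pair_big predT predT (fun j k => law mu Y j * law mu Z k)) /=.
    under eq_bigr do rewrite -mulr_sumr (law_sum mu mZ) mulr1.
    by rewrite (law_sum mu mY).
rewrite /shannon -opprD lerN2.
have -> : \sum_i law mu Y i * ln (law mu Y i) =
    \sum_j law mu YZ j * ln (law mu Y j.1).
  by rewrite -(mean_comp mu fst (fun i => ln (law mu Y i)) mYZ).
have -> : \sum_i law mu Z i * ln (law mu Z i) =
    \sum_j law mu YZ j * ln (law mu Z j.2).
  by rewrite -(mean_comp mu snd (fun i => ln (law mu Z i)) mYZ).
rewrite -big_split /=; apply: ler_sum => j _.
have [->|j0] := eqVneq (law mu YZ j) 0; first by rewrite !mul0r addr0.
by have [h1 h2] := pos _ j0; rewrite lnM // mulrDr.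
Qed.

Variable f : T -> T.
Hypothesis mf : measurable_fun setT f.
Hypothesis f_inv : measure_invariant mu f.

Lemma measurable_iter n : measurable_fun setT (iter n f).
Proof.
elim: n => [|n IH]; first exact: measurable_id.
exact: (measurableT_comp mf IH).
Qed.

Lemma measurable_iter_pre n B : measurable B -> measurable (iter n f @^-1` B).
Proof. by move=> mB; rewrite -[X in measurable X]setTI; exact: measurable_iter. Qed.

Lemma invariant_iter n B : measurable B -> mu (iter n f @^-1` B) = mu B.
Proof.
elim: n B => [//|n IH] B mB.
transitivity (mu (iter n f @^-1` (f @^-1` B))); first by [].
by rewrite IH ?f_inv // -[X in measurable X]setTI; exact: mf.
Qed.

Lemma fmeas_iter (J : finType) (Y : T -> J) n : fmeas Y -> fmeas (Y \o iter n f).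
Proof. by move=> mY j; exact: (measurable_iter_pre n (mY j)). Qed.

Lemma law_iter (J : finType) (Y : T -> J) n : fmeas Y ->
  law mu (Y \o iter n f) = law mu Y.
Proof.
by move=> mY; apply/funext => j; rewrite /law -(invariant_iter n (mY j)).
Qed.

Lemma fmeas_process (J : finType) (Y : T -> J) n : fmeas Y -> fmeas (process f Y n).
Proof. by move=> mY; apply: fmeas_ffun => i; exact: fmeas_iter. Qed.

(** The name of length n + m is a function of the n-name at x and the m-name at f^n x; by invariance
    the latter has the law of the m-name at x. *)
Lemma shannon_process_sub (J : finType) (Y : T -> J) n m : fmeas Y ->
  H (process f Y (n + m)) <= H (process f Y n) + H (process f Y m).
Proof.
move=> mY.
pose g (uv : {ffun 'I_n -> J} * {ffun 'I_m -> J}) : {ffun 'I_(n + m) -> J} :=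
  [ffun i : 'I_(n + m) =>
     match fintype.split i with inl j => uv.1 j | inr k => uv.2 k end].
have -> : process f Y (n + m) =
    g \o (fun x => (process f Y n x, (process f Y m \o iter n f) x)).
  apply/funext => x; apply/ffunP => i; rewrite !ffunE.
  case: splitP => j ij; rewrite !ffunE ij //.
  by rewrite addnC iterD.
have mYn : fmeas (process f Y n) by exact: fmeas_process.
have mYm : fmeas (process f Y m) by exact: fmeas_process.
have mYm' : fmeas (process f Y m \o iter n f) by exact: fmeas_iter.
apply: (le_trans (shannon_comp g (fmeas_pair mYn mYm'))).
by apply: (le_trans (shannon_pair mYn mYm')); rewrite law_iter.
Qed.

(** Fekete's lemma for the superadditive sequence - H; the limit of H / n is therefore an infimum,
    which gives the bound for every n. *)
Lemma process_entropy_cvg (J : finType) (Y : T -> J) : fmeas Y ->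
  cvgn (fun n => n%:R^-1 * H (process f Y n)) /\
  forall n, (0 < n)%N ->
    limn (fun n => n%:R^-1 * H (process f Y n)) <= n%:R^-1 * H (process f Y n).
Proof.
move=> mY; pose h n := H (process f Y n).
pose a n := (- h n)%:E.
have h0 n : 0 <= h n by apply: shannon_law_ge0; exact: fmeas_process.
have := @fekete R a 0%N.
set s := ereal_sup _ => fk.
have {fk} : (fun n => n%:R^-1%:E * a n)%E @ \oo --> s.
  apply: fk => [n m b c _ _|n _]; last exact: ltNyr.
  rewrite /a !lte_fin => hn hm; apply: lt_le_trans (ltrD hn hm) _.
  by rewrite -opprD lerN2; exact: shannon_process_sub.
have s0 : (s <= 0)%E.
  apply: ge_ereal_sup => _ [n _ <-]; rewrite /a -EFinM lee_fin mulrN oppr_le0.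
  by rewrite mulr_ge0 ?invr_ge0 ?ler0n.
have su n : (0 < n)%N -> (n%:R^-1%:E * a n <= s)%E.
  by move=> n0; apply: ereal_sup_ubound; exists n.
have : (-oo < s)%E.
  by apply: lt_le_trans (su 1%N isT); rewrite /a -EFinM ltNyr.
case: s s0 su => [s||] // _ su _ as_.
have cv : (fun n => n%:R^-1 * h n) @ \oo --> - s.
  have /fine_cvgP[_ cv] := as_.
  rewrite (_ : (fun n => _) = (fun n => - (n%:R^-1 * - h n))); last first.
    by apply/funext => n; rewrite mulrN opprK.
  exact: cvgN.
split; first by apply/cvg_ex; exists (- s).
move=> n n0; rewrite -/(h n); have -> := cvg_lim _ cv => //.
have := su n n0; rewrite /a -EFinM lee_fin mulrN; lra.
Qed.

(** Coding a partition by the map that returns the index of the piece turns its iterated joins into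
    fibres of [process]. *)
Lemma partition_fun (I : finType) (P : I -> set T) : measurable_partition P ->
  exists2 Y : T -> I, fmeas Y & forall i, P i = Y @^-1` [set i].
Proof.
move=> [mP tP cP].
have /choice[Y hY] : forall x, exists i, P i x.
  by move=> x; have : setT x by []; rewrite -cP => -[i _ Pi]; exists i.
have PE i : P i = Y @^-1` [set i].
  apply/seteqP; split => x /= => [Pi|<- //].
  by apply: (tP _ _ Logic.I Logic.I); exists x; split.
by exists Y => // i; rewrite -PE.
Qed.

Lemma entropy_wrt_process (J : finType) (Y : T -> J) :
  entropy_wrt mu f (fun j => Y @^-1` [set j]) =
  limn (fun n => n%:R^-1 * H (process f Y n)).
Proof.
rewrite /entropy_wrt; congr (limn _); apply/funext => n; congr (_ * _).
rewrite /partition_entropy /shannon /law; congr (- _); apply: eq_bigr => w _.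
have -> // : iterated_join f (fun j => Y @^-1` [set j]) w = process f Y n @^-1` [set w].
apply/seteqP; split => x /=.
  by move=> h; apply/ffunP => i; rewrite ffunE; exact: (h i).
by move=> <- i _ /=; rewrite ffunE.
Qed.

Lemma ks_entropy_ge (k : nat) (Y : T -> 'I_k) : fmeas Y ->
  ((limn (fun n => n%:R^-1 * H (process f Y n)))%:E <= ks_entropy mu f)%E.
Proof.
move=> mY; apply: ereal_sup_ubound; exists k, (fun j => Y @^-1` [set j]).
rewrite entropy_wrt_process; split => //; split => //.
  by move=> i j _ _ [x [/= <- <-]].
by apply/seteqP; split => x // _; exists (Y x).
Qed.

Lemma ks_entropy_le (c : \bar R) :
  (forall (k : nat) (Y : T -> 'I_k), fmeas Y ->
    (limn (fun n => n%:R^-1 * H (process f Y n)))%:E <= c)%E ->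
  (ks_entropy mu f <= c)%E.
Proof.
move=> h; apply: ge_ereal_sup => _ [k [P [/partition_fun[Y mY PE] ->]]].
have -> : P = (fun j => Y @^-1` [set j]) by apply/funext.
by rewrite entropy_wrt_process; exact: h.
Qed.

End entropy_rv.

(** * Markov shifts and bounded distortion *)

Section tms_combinatorics.
Context {S : countType} {A : rel S}.
Local Notation X := (tms A).
Local Notation T := (@tms_shift S A).
Local Notation c := (@tms_coord S A).

Lemma tms_coordP (x : X) i : A (c x i) (c x i.+1).
Proof. exact: (set_valP x). Qed.

Lemma tms_ext (x y : X) : (forall i, c x i = c y i) -> x = y.
Proof. by move=> h; apply: val_inj; apply/funext. Qed.

Lemma tms_ex (y : nat -> S) : (forall i, A (y i) (y i.+1)) ->
  exists x : X, forall i, c x i = y i.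
Proof.
move=> h; have h' : (y : prod_topology (fun=> discrete_topology S)) \in tms_set A.
  exact/mem_set.
by exists (exist (fun y => y \in tms_set A) _ h').
Qed.

Lemma coord_iter n (x : X) i : c (iter n T x) i = c x (n + i)%N.
Proof.
elim: n i => [|n IH] i; first by [].
by rewrite iterS; transitivity (c (iter n T x) i.+1); rewrite // IH addnS addSn.
Qed.

Lemma splice n (x y : X) : c x n = c y 0 -> exists z : X,
  (forall i, (i <= n)%N -> c z i = c x i) /\ (forall i, c z (n + i)%N = c y i).
Proof.
move=> xy; pose w i := if (i < n)%N then c x i else c y (i - n)%N.
have [i|z hz] := @tms_ex w.
  rewrite /w; case: (ltngtP i.+1 n) => [lt|gt|eq].
  - exact: tms_coordP.
  - by rewrite subSn //; exact: tms_coordP.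
  - by rewrite eq subnn -xy -eq; exact: tms_coordP.
exists z; split => i; rewrite hz /w; last by rewrite ltnNge leq_addr /= addKn.
by rewrite leq_eqVlt => /orP[/eqP->|->//]; rewrite ltnn subnn.
Qed.

Lemma periodic_closure n (x : X) : (0 < n)%N -> c x n = c x 0 ->
  exists z : X, iter n T z = z /\ forall i, (i <= n)%N -> c z i = c x i.
Proof.
move=> n0 xn; pose w i := c x (i %% n)%N.
have [i|z hz] := @tms_ex w.
  rewrite /w -addn1 -modnDml addn1.
  have := ltn_pmod i n0; set r := (i %% n)%N; rewrite leq_eqVlt => /orP[/eqP rn|rn].
    by rewrite rn modnn -xn -rn; exact: tms_coordP.
  by rewrite (modn_small rn); exact: tms_coordP.
exists z; split; first by apply: tms_ext => i; rewrite coord_iter !hz /w modnDl.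
move=> i; rewrite leq_eqVlt hz /w => /orP[/eqP->|lt]; last by rewrite modn_small.
by rewrite modnn.
Qed.

Lemma periodic_coord n (x : X) i : iter n T x = x -> c x i = c x (i %% n)%N.
Proof.
move=> px; rewrite {1}(divn_eq i n).
elim: (i %/ n)%N => [|k IH]; first by rewrite mul0n add0n.
by rewrite mulSn -addnA -coord_iter px.
Qed.

Lemma periodic_ext n (x y : X) : (0 < n)%N -> iter n T x = x -> iter n T y = y ->
  (forall i, (i < n)%N -> c x i = c y i) -> x = y.
Proof.
move=> n0 px py xy; apply: tms_ext => i.
by rewrite (periodic_coord i px) (periodic_coord i py) xy // ltn_pmod.
Qed.

Lemma cycle_point (s : S) (w : seq S) : path A s (rcons w s) ->
  exists x : X, forall i, (i <= size w)%N -> c x i = nth s (s :: w) i.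
Proof.
move=> /(pathP s) hw; rewrite size_rcons in hw.
pose n := (size w).+1; pose y i := nth s (s :: w) (i %% n)%N.
have [i|x hx] := @tms_ex y; last first.
  by exists x => i iw; rewrite hx /y modn_small.
rewrite /y -addn1 -modnDml addn1.
have := ltn_pmod i (ltn0Sn (size w)); rewrite -/n; set r := (i %% n)%N => rn.
have := hw r rn; rewrite nth_rcons -rcons_cons nth_rcons /= rn.
move: (rn); rewrite ltnS leq_eqVlt => /orP[/eqP ->|rw].
  by rewrite ltnn eqxx modnn.
by rewrite rw modn_small.
Qed.

(** Mixing gives only finite paths. A path from s to t is followed by one from t back to s, and the
    resulting cycle is repeated for ever to obtain a point of X. *)
Lemma mixing_point (mixA : topologically_mixing A) (s t : S) :
  exists N, forall p, (N <= p)%N -> exists x : X, c x 0 = s /\ c x p = t.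
Proof.
have [N hN] := mixA s t; have [N' hN'] := mixA t s.
have [u hu] := hN' N' (leqnSn _).
exists N.+1 => -[|p] // Np; have [v hv] := hN p (leqW Np).
have hp : path A s (rcons (v ++ t :: u) s).
  by rewrite rcons_cat -cat_rcons cat_path hv last_rcons.
have [x hx] := cycle_point hp; exists x; split; first by rewrite hx.
by rewrite hx /= ?size_cat ?size_tuple ?leq_addr ?nth_cat ?size_tuple ?ltnn ?subnn //=
   addnS ltnS leq_addr.
Qed.

Context {R : realType} (phi : X -> R).
Local Notation sphi := (birkhoff T phi).

Lemma birkhoffD n m (x : X) : sphi (n + m) x = sphi n x + sphi m (iter n T x).
Proof.
rewrite /birkhoff big_split_ord /=; congr (_ + _).
by apply: eq_bigr => i _; rewrite addnC iterD.
Qed.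

Lemma birkhoff0 (x : X) : sphi 0 x = 0.
Proof. by rewrite /birkhoff big_ord0. Qed.

Lemma tms_var_le n (g : X -> R) (v : R) (x y : X) : (tms_var n g <= v%:E)%E ->
  (forall i, (i < n)%N -> c x i = c y i) -> `|g x - g y| <= v.
Proof.
move=> gv xy; rewrite -lee_fin; apply: le_trans gv; apply: ereal_sup_ubound.
by exists (x, y).
Qed.

Lemma tms_var_lt n (g : X -> R) (x0 : X) : (tms_var n g < +oo)%E ->
  exists v : R, forall x y, (forall i, (i < n)%N -> c x i = c y i) -> `|g x - g y| <= v.
Proof.
move=> gv; exists (fine (tms_var n g)) => x y; apply: tms_var_le.
rewrite fineK // fin_numE -ltey gv andbT; apply/eqP => gN.
have : (0 <= tms_var n g)%E.
  apply: ereal_sup_ubound; exists (x0, x0) => //=.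
  by rewrite subrr normr0.
by rewrite gN.
Qed.

(** For n > k the first n - k terms see agreement on k further coordinates and differ by at most 1,
    by the Walters limit; the last k terms, and all sums with n <= k, are controlled by the
    finiteness of the variations. *)
Lemma walters_distortion (x0 : X) : walters phi -> exists2 C : R, 0 <= C &
  forall n x y, (forall i, (i <= n)%N -> c x i = c y i) -> `|sphi n x - sphi n y| <= C.
Proof.
move=> [_ w0 wfin].
have [k [k1 hk]] : exists k, (0 < k)%N /\ forall n x y, (0 < n)%N ->
    (forall i, (i < n + k)%N -> c x i = c y i) -> `|sphi n x - sphi n y| <= 1.
  have [K _ hK] : \forall k \near \oo, (ereal_sup
        [set tms_var (n + k) (sphi n) | n in [set n : nat | (1 <= n)%N]] <= 1%:E)%E.
    have /fine_cvgP[fin /cvgrPdist_le/(_ 1 ltr01)] := w0.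
    move: fin; apply: filterS2 => k /=; case: ereal_sup => // r _ /=.
    by rewrite sub0r normrN lee_fin; apply: le_trans; exact: ler_norm.
  exists K.+1; split => // n x y n1 xy.
  apply: (@tms_var_le (n + K.+1) (sphi n)) => //.
  apply: le_trans (hK K.+1 (leqnSn _)); apply: ereal_sup_ubound; by exists n.
have /choice[D hD] : forall n, exists v : R, forall x y,
    (forall i, (i <= n)%N -> c x i = c y i) -> `|sphi n x - sphi n y| <= v.
  case=> [|n].
    by exists 0 => x y _; rewrite !birkhoff0 subrr normr0.
  (* Agreement on the coordinates 0 to n.+1 is agreement on n.+2 of them, the case k = 1 of the
     finiteness condition. *)
  have := wfin 1%N n.+1 isT isT; rewrite addn1 => /(tms_var_lt x0)[v hv].
  by exists v => x y xy; apply: hv => i; rewrite ltnS; exact: xy.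
have D0 n : 0 <= D n by have := hD n x0 x0 (fun _ _ => erefl); apply: le_trans.
pose C := 1 + \sum_(n < k.+1) D n.
have DC n : (n <= k)%N -> D n <= \sum_(n < k.+1) D n.
  move=> nk; have nk' : (n < k.+1)%N by [].
  by rewrite (bigD1 (Ordinal nk')) //= lerDl sumr_ge0.
exists C; first by rewrite addr_ge0 // sumr_ge0.
move=> n x y xy; have [nk|kn] := leqP n k.
  apply: (le_trans (hD _ _ _ xy)); apply: le_trans (DC _ nk) _.
  by rewrite lerDr.
have nE : n = ((n - k) + k)%N by rewrite subnK // ltnW.
rewrite nE !birkhoffD opprD addrACA; apply: (le_trans (ler_normD _ _)).
apply: lerD.
  by apply: hk; rewrite ?subn_gt0 // -nE => i /ltnW; exact: xy.
apply: le_trans (DC k (leqnn _)); apply: hD => i ik.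
by rewrite !coord_iter; apply: xy; lia.
Qed.

End tms_combinatorics.

(** * Gurevich pressure *)

Lemma lt_lne (R : realType) (al : R) (z : \bar R) : (0 <= z)%E ->
  (al%:E < lne z)%E = ((expR al)%:E < z)%E.
Proof.
case: z => [z||] //; last by rewrite /= !ltry.
rewrite lee_fin le_eqVlt => /orP[/eqP <-|z0].
  by rewrite le0_lneNy // lte_fin [RHS]ltNge expR_ge0.
by rewrite lne_EFin // !lte_fin -[in RHS](lnK z0) ltr_expR.
Qed.

Section pressure.
Context {S : countType} {A : rel S} {R : realType} (phi : tms A -> R) (a : S).
Local Notation X := (tms A).
Local Notation T := (@tms_shift S A).
Local Notation c := (@tms_coord S A).
Local Notation sphi := (birkhoff T phi).
Local Notation Z := (partition_function phi a).

Definition loops n : set X := [set x | iter n T x = x /\ c x 0 = a].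

Lemma partition_function_ge n (s : seq X) : uniq s -> {in s, forall x, loops n x} ->
  ((\sum_(x <- s) expR (sphi n x))%:E <= Z n)%E.
Proof.
move=> us sl; apply: ereal_sup_ubound; exists [set` s].
  by split; [exact: finite_seq|move=> x /sl].
by rewrite -fsbig_seq // -sumEFin.
Qed.

(** All counting is done on finite duplicate-free lists of loops, which exhaust the possibly
    infinite sum Z_n. *)
Lemma partition_function_gt n (r : R) : (r%:E < Z n)%E ->
  exists s : seq X, [/\ uniq s, {in s, forall x, loops n x} &
    r < \sum_(x <- s) expR (sphi n x)].
Proof.
move=> /ereal_sup_gt[_ [B [finB Bl] <-]].
rewrite fsbig_finite //= sumEFin lte_fin => h.
exists (finmap.enum_fset (fset_set B)); split => //; first exact: finmap.fset_uniq.
by move=> x xB; apply: Bl; move: xB; rewrite in_fset_set // inE.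
Qed.

Lemma partition_function_ge0 n : (0 <= Z n)%E.
Proof. by apply: esum_ge0 => x _; rewrite lee_fin expR_ge0. Qed.

Variable C : R.
Hypothesis distC : forall n x y, (forall i, (i <= n)%N -> c x i = c y i) ->
  `|sphi n x - sphi n y| <= C.

Lemma loop_coord n x : loops n x -> c x n = a.
Proof. by move=> [px xa]; rewrite -(addn0 n) -coord_iter px. Qed.

(** A loop of length n followed by one of length m is a loop of length n + m, from which both can be
    recovered. Each of the two Birkhoff sums changes by at most C under concatenation. *)
Lemma partition_function_mul n m (al be : R) : (0 < n)%N -> (0 < m)%N ->
  ((expR al)%:E < Z n)%E -> ((expR be)%:E < Z m)%E ->
  ((expR (al + be - 2 * C))%:E < Z (n + m))%E.
Proof.
move=> n0 m0 /partition_function_gt[s [us sl sS]] /partition_function_gt[t [ut tl tS]].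
have /choice[z hz] : forall p : X * X, exists z : X, loops n p.1 -> loops m p.2 ->
    [/\ loops (n + m) z, forall i, (i <= n)%N -> c z i = c p.1 i &
        forall i, (i <= m)%N -> c z (n + i) = c p.2 i].
  move=> [x y] /=; have [lx|] := pselect (loops n x); last by exists x.
  have [ly|] := pselect (loops m y); last by exists x.
  have [|w [w1 w2]] := @splice _ _ n x y; first by rewrite (loop_coord lx) ly.2.
  have [||w' [pw' ww']] := @periodic_closure _ _ (n + m) w.
  - by rewrite addn_gt0 n0.
  - by rewrite w2 (loop_coord ly) w1 // lx.2.
  exists w' => _ _; split.
  - by split => //; rewrite ww' // w1 // lx.2.
  - by move=> i ni; rewrite ww' ?w1 // (leq_trans ni) // leq_addr.
  - by move=> i mi; rewrite ww' ?w2 // leq_add2l.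
pose r := [seq z p | p <- [seq (x, y) | x <- s, y <- t]].
have inr p : p \in [seq (x, y) | x <- s, y <- t] -> loops n p.1 /\ loops m p.2.
  by move=> /allpairsP[[x y] /= [xs yt ->]]; split; [exact: sl|exact: tl].
have ur : uniq r.
  rewrite map_inj_in_uniq; first by rewrite allpairs_uniq // => -[? ?] [? ?].
  move=> [x y] [x' y'] /inr[/= lx ly] /inr[/= lx' ly'] zz.
  have [_ h1 h2] := hz (x, y) lx ly; have [_ h1' h2'] := hz (x', y') lx' ly'.
  congr (_, _).
    apply: (periodic_ext n0 lx.1 lx'.1) => i /ltnW ni.
    by rewrite -(h1 _ ni) -(h1' _ ni) zz.
  apply: (periodic_ext m0 ly.1 ly'.1) => i /ltnW ni.
  by rewrite -(h2 _ ni) -(h2' _ ni) zz.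
apply: lt_le_trans (partition_function_ge ur _); last first.
  by move=> _ /mapP[p /inr[l1 l2] ->]; have [] := hz p l1 l2.
rewrite lte_fin big_map.
apply: (@lt_le_trans _ _ (\sum_(p <- [seq (x, y) | x <- s, y <- t])
   expR (sphi n p.1 + sphi m p.2 - 2 * C))); last first.
  rewrite [leLHS]big_seq [leRHS]big_seq; apply: ler_sum => p /inr[l1 l2].
  have [_ h1 h2] := hz p l1 l2.
  rewrite ler_expR birkhoffD.
  have := distC h1; have : `|sphi m (iter n T (z p)) - sphi m p.2| <= C.
    by apply: distC => i im; rewrite coord_iter h2.
  by rewrite !ler_norml => /andP[? ?] /andP[? ?]; lra.
have -> : \sum_(p <- [seq (x, y) | x <- s, y <- t]) expR (sphi n p.1 + sphi m p.2 - 2 * C) =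
    (\sum_(x <- s) expR (sphi n x)) * (\sum_(y <- t) expR (sphi m y)) * expR (- (2 * C)).
  rewrite big_allpairs /= big_distrlr /= mulr_suml; apply: eq_bigr => x _.
  by rewrite mulr_suml; apply: eq_bigr => y _; rewrite !expRD.
by rewrite !expRD ltr_pM2r ?expR_gt0 // ltr_pM ?expR_ge0.
Qed.

Hypothesis mixA : topologically_mixing A.

(** Subtracting 2C makes log Z_n superadditive, and mixing makes Z_n positive for all large n, so
    Fekete's lemma applies; the constant vanishes after division by n. *)
Lemma pressure_cvg :
  (-oo < gurevich_pressure phi a)%E /\
  gurevich_pressure phi a = ereal_sup
    [set (n%:R^-1%:E * (lne (Z n) - (2 * C)%:E))%E | n in [set n | (0 < n)%N]].
Proof.
pose b n := (lne (Z n) - (2 * C)%:E)%E.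
have bE n (al : R) : (al%:E < b n)%E = ((expR (al + 2 * C))%:E < Z n)%E.
  by rewrite -(lt_lne _ (partition_function_ge0 n)) /b lteBrDr // EFinD.
have [N hN] := mixing_point mixA a a.
have Zpos n : (N.+1 <= n)%N -> (0 < Z n)%E.
  move=> Nn; have n0 : (0 < n)%N by apply: leq_trans Nn.
  have [x [x0 xn]] := hN n (ltnW Nn).
  have [|z [pz zx]] := @periodic_closure _ _ n x n0; first by rewrite xn x0.
  have := @partition_function_ge n [:: z] isT.
  rewrite big_seq1 => h; apply: lt_le_trans (h _); first by rewrite lte_fin expR_gt0.
  by move=> y; rewrite mem_seq1 => /eqP ->; split => //; rewrite zx.
have bN n : (N.+1 <= n)%N -> (-oo < b n)%E.
  move=> /Zpos; rewrite /b; case: (Z n) => [z z0|_|] //.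
  by rewrite lne_EFin // -EFinB ltNyr.
have fk := @fekete R b N.+1.
have {}fk := fk _ bN.
have {}fk : (fun n => n%:R^-1%:E * b n)%E @ \oo --> ereal_sup
    [set (n%:R^-1%:E * b n)%E | n in [set n | (0 < n)%N]].
  apply: fk => n m al be n0 m0; rewrite !bE => h1 h2.
  have := partition_function_mul n0 m0 h1 h2; congr (_ < _)%E.
  by congr (expR _)%:E; lra.
set s := ereal_sup _ in fk *.
have sN : (-oo < s)%E.
  apply: (@lt_le_trans _ _ (N.+1%:R^-1%:E * b N.+1)%E); last first.
    by apply: ereal_sup_ubound; exists N.+1.
  have := bN N.+1 (leqnn _); case: (b _) => [r||] // _.
    by rewrite -EFinM ltNyr.
  by rewrite gt0_muley // lte_fin invr_gt0 ltr0n.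
suff -> : gurevich_pressure phi a = s by [].
apply: cvg_lim => //.
have c0 : (fun n => (n%:R^-1 * (2 * C))%:E) @ \oo --> (0 : R)%:E.
  apply: cvg_EFin; first by near=> n.
  rewrite -(mul0r (2 * C)); apply: cvgM; last exact: cvg_cst.
  by apply/gtr0_cvgV0; [near=> n; rewrite ltr0n; near: n; exists 1%N|exact: cvgr_idn].
have s0 : (s +? (0 : R)%:E)%E by rewrite fin_num_adde_defl.
have h : (fun n => n%:R^-1%:E * b n + (n%:R^-1 * (2 * C))%:E)%E @ \oo --> (s + 0%:E)%E.
  exact: cvgeD s0 fk c0.
rewrite adde0 in h; apply: cvg_trans h.
apply: near_eq_cvg; near=> n.
have n0 : (0 < n)%N by near: n; exists 1%N.
rewrite /= EFinM -muleDr ?fin_num_adde_defl //.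
by rewrite /b subeK.
Unshelve. all: by end_near.
Qed.

Lemma pressure_gt (r : R) : (r%:E < gurevich_pressure phi a)%E ->
  exists n (s : seq X), [/\ (0 < n)%N, uniq s, {in s, forall x, loops n x} &
    expR (n%:R * r + 2 * C) < \sum_(x <- s) expR (sphi n x)].
Proof.
have [_ ->] := pressure_cvg => /ereal_sup_gt[_ [n n0 <-]].
have {}n0 : (0 < n)%N := n0.
rewrite lte_pdivlMl ?ltr0n // lteBrDr // -EFinM -EFinD.
rewrite (lt_lne _ (partition_function_ge0 n)) => /partition_function_gt[s [us sl h]].
by exists n, s.
Qed.

(** The supremum formula bounds Z_n at every single n, not only asymptotically. *)
Lemma pressure_le (p : R) n (s : seq X) : gurevich_pressure phi a = p%:E ->
  (0 < n)%N -> uniq s -> {in s, forall x, loops n x} ->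
  \sum_(x <- s) expR (sphi n x) <= expR (n%:R * p + 2 * C).
Proof.
have [_ ->] := pressure_cvg => pE n0 us sl; rewrite leNgt; apply/negP => h.
have : ((expR (n%:R * p + 2 * C))%:E < Z n)%E.
  by apply: lt_le_trans (partition_function_ge us sl); rewrite lte_fin.
rewrite -(lt_lne _ (partition_function_ge0 n)) EFinD -lteBrDr // EFinM.
rewrite -lte_pdivlMl ?ltr0n // -pE ltNge => /negP; apply.
by apply: ereal_sup_ubound; exists n.
Qed.

End pressure.

(** * Weights on lumped words *)

(** Only finitely many states have code below m, so the thresholds of a monotone property have a
    maximum over them. *)
Lemma uniform_bound (S : countType) (d : Order.disp_t) (V : orderType d) (v0 : V)
    (Q : S -> V -> Prop) (m : nat) :
  (forall s v w, (v <= w)%O -> Q s v -> Q s w) -> (forall s, exists v, Q s v) ->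
  exists v, forall s, (pickle s < m)%N -> Q s v.
Proof.
move=> Qmon Qex; elim: m => [|m [v hv]]; first by exists v0.
have [[s sm]|ns] := pselect (exists s : S, pickle s = m); last first.
  exists v => s; rewrite ltnS leq_eqVlt => /orP[/eqP sm|]; last exact: hv.
  by exfalso; apply: ns; exists s.
have [w hw] := Qex s; exists (Order.max v w) => t; rewrite ltnS leq_eqVlt.
move=> /orP[/eqP tm|tm]; last by apply: Qmon (hv t tm); rewrite le_max lexx.
have -> : t = s by apply: (pcan_inj (@pickleK S)); rewrite tm sm.
by apply: Qmon hw; rewrite le_max lexx orbT.
Qed.

Section letters.
Context {S : countType} {A : rel S}.
Local Notation X := (tms A).
Local Notation T := (@tms_shift S A).
Local Notation c := (@tms_coord S A).

(* States coded below m keep their identity; all others are lumped into one letter. *)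
Definition letter (m : nat) (x : X) : 'I_m.+1 := inord (minn (pickle (c x 0)) m).

Lemma letterE m x : letter m x = minn (pickle (c x 0)) m :> nat.
Proof. by rewrite inordK // ltnS geq_minr. Qed.

Lemma letter_lt m x : (letter m x < m)%N = (pickle (c x 0) < m)%N.
Proof. by rewrite letterE gtn_min ltnn orbF. Qed.

Lemma letter_inj m x y : (letter m x < m)%N -> letter m x = letter m y ->
  c x 0 = c y 0.
Proof.
move=> xm xy; have ym : (letter m y < m)%N by rewrite -xy.
have := congr1 (@nat_of_ord _) xy; rewrite !letterE.
move: xm ym; rewrite !letter_lt => xm ym.
by rewrite (minn_idPl (ltnW xm)) (minn_idPl (ltnW ym)); apply: (pcan_inj pickleK).
Qed.

Definition outside (m L : nat) (w : {ffun 'I_L -> 'I_m.+1}) : nat :=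
  \sum_(t < L) ~~ (w t < m)%N.

Definition letter_word (m L : nat) : X -> {ffun 'I_L -> 'I_m.+1} :=
  @process X _ T (letter m) L.

End letters.

Lemma sum_ltn_ord L i : (\sum_(t < L) (t < i)%N)%N = minn i L.
Proof.
elim: L => [|L IH]; first by rewrite big_ord0 minn0.
by rewrite big_ord_recr /= IH; lia.
Qed.

Lemma sum_gtn_ord L j : (\sum_(t < L) (j < t)%N)%N = (L - j.+1)%N.
Proof.
elim: L => [|L IH]; first by rewrite big_ord0.
by rewrite big_ord_recr /= IH; lia.
Qed.

Section weights.
Context {S : countType} {A : rel S} {R : realType} (phi : tms A -> R) (a : S).
Local Notation X := (tms A).
Local Notation T := (@tms_shift S A).
Local Notation c := (@tms_coord S A).
Local Notation sphi := (birkhoff T phi).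

Variable C : R.
Hypothesis distC : forall n x y, (forall i, (i <= n)%N -> c x i = c y i) ->
  `|sphi n x - sphi n y| <= C.
Hypothesis mixA : topologically_mixing A.
Variable P : R.
Hypothesis PE : gurevich_pressure phi a = P%:E.

(* Prefixing a path from a and appending a path back to a, both of the fixed
   length p, turns the x j into distinct loops at a. *)
Lemma bridge_sum (m : nat) : exists2 K : R, 0 <= K &
  forall l (J : finType) (Q : pred J) (x : J -> X),
    (forall j, Q j -> (pickle (c (x j) 0) < m)%N /\ (pickle (c (x j) l) < m)%N) ->
    (forall j j', Q j -> Q j' -> (forall i, (i <= l)%N -> c (x j) i = c (x j') i) -> j = j') ->
    \sum_(j | Q j) expR (sphi l (x j)) <= expR (K + l%:R * P).
Proof.
have [N hN] : exists N, forall s, (pickle s < m)%N -> forall p, (N <= p)%N ->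
   (exists x : X, c x 0 = a /\ c x p = s) /\ (exists x : X, c x 0 = s /\ c x p = a).
  apply: (@uniform_bound S _ nat 0%N (fun s N => forall p, (N <= p)%N ->
   (exists x : X, c x 0 = a /\ c x p = s) /\ (exists x : X, c x 0 = s /\ c x p = a))).
    by move=> s v w vw h p wp; apply: h; apply: leq_trans wp.
  move=> s; have [N1 h1] := mixing_point mixA a s; have [N2 h2] := mixing_point mixA s a.
  by exists (N1 + N2)%N => p hp; split; [apply: h1|apply: h2]; lia.
(* All bridges have this one length; p > 0 keeps the length of the closed loops positive. *)
pose p := N.+1.
have [D hD] : exists D : R, forall s, (pickle s < m)%N -> exists u v : X,
    [/\ c u 0 = a /\ c u p = s, c v 0 = s /\ c v p = a, - D <= sphi p u & - D <= sphi p v].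
  have [|s|D hD] := @uniform_bound S _ R 0 (fun s D => (pickle s < m)%N -> exists u v : X,
    [/\ c u 0 = a /\ c u p = s, c v 0 = s /\ c v p = a, - D <= sphi p u & - D <= sphi p v])
    m.
  - by move=> s v w vw h /h[u1 [u2 [h1 h2 h3 h4]]]; exists u1, u2; split => //; lra.
  - have [sm|] := boolP (pickle s < m)%N; last by exists 0.
    have [[u hu] [v hv]] := hN s sm p (leqnSn _).
    exists (`|sphi p u| + `|sphi p v|) => _; exists u, v; split => //.
      by have := ler_norm (- sphi p u); have := normr_ge0 (sphi p v); rewrite normrN; lra.
    by have := ler_norm (- sphi p v); have := normr_ge0 (sphi p u); rewrite normrN; lra.
  by exists D => s sm; apply: hD.
(* 3C pays for the distortion on prefix, path and suffix, 2D for the sums along the two bridges, 2C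
   for [pressure_le], and 2pP for the extra length. *)
pose K := 5 * C + 2 * D + 2 * p%:R * P.
exists (Num.max 0 K); first by rewrite le_max lexx.
move=> l J Q x xm xinj.
have /choice[z hz] : forall j, exists z : X, Q j ->
    [/\ loops a (p + (l + p)) z, forall i, (i <= l)%N -> c z (p + i) = c (x j) i &
       sphi l (x j) - 3 * C - 2 * D <= sphi (p + (l + p)) z].
  move=> j; have [Qj|] := boolP (Q j); last by exists (x j).
  have [x0m xlm] := xm j Qj.
  have [u [_ [[ua us] _ uD _]]] := hD _ x0m; have [_ [v [_ [vs va] _ vD]]] := hD _ xlm.
  have [|w [w1 w2]] := @splice _ _ l (x j) v; first by rewrite vs.
  have [|y [y1 y2]] := @splice _ _ p u w; first by rewrite us w1.
  have [||z [pz zy]] := @periodic_closure _ _ (p + (l + p)) y => //.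
    by rewrite y2 w2 va y1.
  have zu i : (i <= p)%N -> c z i = c u i.
    by move=> ip; rewrite zy ?y1 // (leq_trans ip) // leq_addr.
  have zx i : (i <= l)%N -> c z (p + i) = c (x j) i.
    by move=> il; rewrite zy ?y2 ?w1 // leq_add2l (leq_trans il) // leq_addr.
  have zv i : (i <= p)%N -> c z (p + (l + i)) = c v i.
    by move=> il; rewrite zy ?y2 ?w2 // !leq_add2l.
  exists z => _; split => //; first by split => //; rewrite zu.
  rewrite !birkhoffD -iterD.
  have d1 := distC zu.
  have d2 : `|sphi l (iter p T z) - sphi l (x j)| <= C.
    by apply: distC => i il; rewrite coord_iter zx.
  have d3 : `|sphi p (iter (l + p) T z) - sphi p v| <= C.
    by apply: distC => i il; rewrite coord_iter (addnC l) -addnA zv.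
  move: d1 d2 d3; rewrite !ler_norml => /andP[? ?] /andP[? ?] /andP[? ?]; lra.
pose s := [seq z j | j <- enum Q].
have us : uniq s.
  rewrite map_inj_in_uniq ?enum_uniq // => j j'.
  rewrite !mem_enum => Qj Qj' zz; apply: xinj => // i il.
  have [_ h _] := hz j Qj; have [_ h' _] := hz j' Qj'.
  by rewrite -h // -h' // zz.
have sl : {in s, forall y, loops a (p + (l + p)) y}.
  by move=> _ /mapP[j /[!mem_enum] Qj ->]; have [] := hz j Qj.
have n0 : (0 < p + (l + p))%N by [].
have := pressure_le distC mixA PE n0 us sl.
rewrite big_map big_enum /= => le.
apply: (@le_trans _ _ (\sum_(j | Q j) expR (sphi (p + (l + p)) (z j)) * expR (3 * C + 2 * D))).
  apply: ler_sum => j Qj; have [_ _ h] := hz j Qj.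
  by rewrite -expRD ler_expR; lra.
rewrite -mulr_suml; apply: (le_trans (ler_wpM2r (expR_ge0 _) le)).
rewrite -expRD ler_expR !natrD.
have : K <= Num.max 0 K by rewrite le_max lexx orbT.
rewrite /K. lra.
Qed.

Variable M : R.
Hypothesis phiM : forall x, phi x <= M.
Hypothesis PM : P <= M.

Lemma birkhoff_le n x : sphi n x <= n%:R * M.
Proof.
rewrite /birkhoff; apply: (@le_trans _ _ (\sum_(i < n) M)); first exact: ler_sum.
by rewrite sumr_const card_ord mulr_natl.
Qed.

Lemma near_max (E : set X) (g : X -> R) (v : R) : E !=set0 -> (forall x, g x <= v) ->
  exists2 y, E y & forall x, E x -> g x <= g y + 1.
Proof.
move=> [x0 Ex0] gv; have hs : has_sup (g @` E).
  by split; [exists (g x0), x0|exists v => _ [x _ <-]].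
have [_ [y Ey <-] hy] := @sup_adherent R (g @` E) 1 ltr01 hs.
exists y => // x Ex; have : g x <= sup (g @` E) by apply: ub_le_sup; [exact: hs.2|exists x].
lra.
Qed.

(** Off the stretch from i to j, phi is at most M while the weight counts P per unit time, so each
    time cut off costs at most M - P. These times are lumped, except j itself, whence the 1 added to
    [outside]. *)
Lemma cover_weights (m : nat) : exists K : R, forall L : nat,
  exists W : {ffun 'I_L -> 'I_m.+1} -> R,
  [/\ forall w, 0 <= W w,
      forall x : X, 0 < W (letter_word m L x),
      forall x : X, sphi L x <= ln (W (letter_word m L x)) +
         (M - P) * (1 + (outside (letter_word m L x))%:R) + 1 &
      \sum_w W w <= (L * L).+1%:R * expR (K + L%:R * P)].
Proof.
have [K K0 hK] := bridge_sum m; exists K => L.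
pose word := {ffun 'I_L -> 'I_m.+1}.
pose good (w : word) (t : 'I_L) := (w t < m)%N.
pose ends (w : word) (ij : 'I_L * 'I_L) :=
  [&& (ij.1 <= ij.2)%N, good w ij.1, good w ij.2 &
    [forall t, good w t ==> (ij.1 <= t <= ij.2)%N]].
pose e (w : word) := [pick ij | ends w ij].
have eN w : e w = None -> forall t, ~~ good w t.
  rewrite /e; case: pickP => // h _ t; apply/negP => gt.
  case: (@arg_minnP _ t (good w) val gt) => i gi imin.
  case: (@arg_maxnP _ t (good w) val gt) => j gj jmax.
  have := h (i, j); rewrite /ends /= gi gj (imin j gj) /= => /negbT/negP; apply.
  by apply/forallP => u; apply/implyP => gu; apply/andP; split; [exact: imin|exact: jmax].
have eS w ij : e w = Some ij -> ends w ij.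
  by rewrite /e; case: pickP => // ij' h [<-].
pose l (ij : 'I_L * 'I_L) := (ij.2 - ij.1)%N.
(* One near-maximising point represents each realised word; its defect 1 is the final summand in the
   bound on [sphi L x]. *)
have /choice[y hy] : forall w, exists y : X, forall ij, e w = Some ij ->
   (exists x : X, letter_word m L x = w) -> letter_word m L y = w /\
   forall x : X, letter_word m L x = w ->
     sphi (l ij) (iter ij.1 T x) <= sphi (l ij) (iter ij.1 T y) + 1.
  move=> w.
  have [N /(_ N (leqnn N))[x0 _]] := mixing_point mixA a a.
  case: (e w) => [ij|]; last by exists x0.
  have [ex|nex] := pselect (exists x : X, letter_word m L x = w); last by exists x0.
  have [z zw zmax] := @near_max [set x : X | letter_word m L x = w]
    (fun x => sphi (l ij) (iter ij.1 T x)) _ ex (fun x => birkhoff_le _ _).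
  by exists z => _ [<-] _; split.
pose V (w : word) := if e w is Some ij then
   expR (sphi (l ij) (iter ij.1 T (y w)) + (L - l ij)%:R * P) else expR (L%:R * P).
(* Words that no point realises get weight 0: only a realised word has a path to be closed up. *)
pose W w := if `[< exists x : X, letter_word m L x = w >] then V w else 0.
have V0 w : 0 < V w by rewrite /V; case: (e w) => *; exact: expR_gt0.
have WE (x : X) : W (letter_word m L x) = V (letter_word m L x).
  by rewrite /W ifT //; apply/asboolP; exists x.
have wordE (x : X) (t : 'I_L) : letter_word m L x t = letter m (iter t T x).
  by rewrite ffunE.
exists W; split => [w|x|x|].
- by rewrite /W; case: ifP => // _; exact: ltW.
- by rewrite WE.
- rewrite WE; set w := letter_word m L x.
  rewrite /V; case ew : (e w) => [[i j]|]; rewrite expRK.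
    have [_ /(_ x erefl) /= h] := hy w (i, j) ew (ex_intro _ x erefl).
    have /and4P[/= ij gi gj /forallP hg] := eS _ _ ew.
    have bad : (i + (L - j) <= 1 + outside w)%N.
      have : (i + (L - j.+1) <= outside w)%N.
        have iL := ltn_ord i; have -> : nat_of_ord i = minn i L by lia.
        rewrite -sum_ltn_ord -sum_gtn_ord -big_split /=; apply: leq_sum => t _.
        have := hg t; rewrite /good; case: (w t < m)%N => /=; last by lia.
        by move=> /andP[? ?]; lia.
      by have := ltn_ord j; lia.
    have LE : L = (i + ((j - i) + (L - j)))%N by have := ltn_ord j; lia.
    have -> : sphi L x = sphi i x + (sphi (j - i) (iter i T x) +
        sphi (L - j) (iter (j - i) T (iter i T x))) by rewrite {1}LE !birkhoffD.
    have h1 := birkhoff_le i x.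
    have h2 := birkhoff_le (L - j) (iter (j - i) T (iter i T x)).
    have -> : (L - (j - i) = i + (L - j))%N by have := ltn_ord j; lia.
    have bR : (i + (L - j))%:R <= 1 + (outside w)%:R :> R.
      by rewrite -[1]/(1%:R) -natrD ler_nat.
    have : (M - P) * (i + (L - j))%:R <= (M - P) * (1 + (outside w)%:R).
      by rewrite ler_wpM2l // subr_ge0.
    move: h; rewrite /l /= natrD; lra.
  have -> : outside w = L.
    rewrite /outside (eq_bigr (fun=> 1%N)) => [|t _]; first by rewrite sum1_card card_ord.
    by have := eN _ ew t; rewrite /good => ->.
  have h := birkhoff_le L x; have h2 : 0 <= (M - P) by rewrite subr_ge0.
  have -> : (M - P) * (1 + L%:R) = L%:R * M - L%:R * P + (M - P) by ring.
  lra.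
(* Words are grouped by their pair (i, j), with one more group for the fully lumped word: L^2 + 1
   groups, each of weight at most e^(K + L P). *)
rewrite (partition_big e predT) //=.
have -> : (L * L).+1%:R = \sum_(o : option ('I_L * 'I_L)) 1 :> R.
  by rewrite sumr_const card_option card_prod card_ord.
rewrite mulr_suml; apply: ler_sum => o _; rewrite mul1r.
case: o => [ij|].
  apply: (@le_trans _ _ (\sum_(w | (e w == Some ij) && `[< exists x : X, letter_word m L x = w >])
     expR (sphi (l ij) (iter ij.1 T (y w))) * expR ((L - l ij)%:R * P))).
    rewrite big_mkcondr /=; apply: ler_sum => w /eqP ew; rewrite /W.
    by case: ifP => // _; rewrite /V ew expRD.
  have lL : (l ij <= L)%N by rewrite /l; have := ltn_ord ij.2; lia.
  rewrite -mulr_suml.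
  have -> : expR (K + L%:R * P) = expR (K + (l ij)%:R * P) * expR ((L - l ij)%:R * P).
    by rewrite -expRD (natrB _ lL); congr (expR _); ring.
  rewrite ler_wpM2r ?expR_ge0 //; apply: hK.
    move=> w /andP[/eqP ew /asboolP exw]; have [yw _] := hy w ij ew exw.
    have /and4P[ij12 gi gj _] := eS _ _ ew.
    rewrite !coord_iter addn0 /l subnKC //.
    have h t : c (y w) t = c (iter t T (y w)) 0 by rewrite coord_iter addn0.
    by rewrite !h -!letter_lt -!wordE yw.
  (* Words with the same (i, j) carry the lumped letter at all times outside [i, j], so the
     coordinates from i to j determine them. *)
  move=> w w' /andP[/eqP ew /asboolP exw] /andP[/eqP ew' /asboolP exw'] hc.
  have [yw _] := hy w ij ew exw; have [yw' _] := hy w' ij ew' exw'.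
  have /and4P[ij12 _ _ /forallP gw] := eS _ _ ew.
  have /and4P[_ _ _ /forallP gw'] := eS _ _ ew'.
  apply/ffunP => t; have [/andP[t1 t2]|nt] := boolP (ij.1 <= t <= ij.2)%N.
    rewrite -yw -yw' !wordE /letter !coord_iter addn0.
    have := hc (t - ij.1)%N; rewrite !coord_iter subnKC // => -> //.
    by rewrite /l leq_sub2r.
  have h (v : word) : good v t ==> (ij.1 <= t <= ij.2)%N -> v t = m :> nat.
    rewrite (negbTE nt) implybF /good -leqNgt => mv; apply/eqP.
    by rewrite eqn_leq mv andbT -ltnS ltn_ord.
  by apply: val_inj; rewrite /= (h w) // (h w').
pose w0 : word := [ffun=> ord_max].
have ew0 w : e w = None -> w = w0.
  move=> /eN ew; apply/ffunP => t; rewrite ffunE; apply: val_inj => /=.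
  have := ew t; rewrite /good -leqNgt => mv.
  by apply/eqP; rewrite eqn_leq mv andbT -ltnS ltn_ord.
apply: (@le_trans _ _ (\sum_(w | w == w0) expR (L%:R * P))); last first.
  by rewrite big_pred1_eq ler_expR lerDr.
rewrite big_mkcond [leRHS]big_mkcond /=; apply: ler_sum => w _.
case: (eqVneq (e w) None) => [ew|_]; last by case: ifP => // _; exact: expR_ge0.
rewrite (ew0 w ew) eqxx /W -(ew0 w ew) /V ew.
by case: ifP => // _; exact: expR_ge0.
Qed.

End weights.

(** * The Borel sigma-algebra of a Markov shift *)

Section tms_borel.
Context {S : countType} {A : rel S}.
Local Notation X := (tms A).
Local Notation T := (@tms_shift S A).
Local Notation c := (@tms_coord S A).

Lemma coord_open (i : nat) (s : S) : open [set x : X | c x i = s].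
Proof.
exists [set y : prod_topology (fun=> discrete_topology S) | y i = s]; last by [].
pose pr (y : prod_topology (fun _ : nat => discrete_topology S)) : discrete_topology S := y i.
have cpr : continuous pr by exact: proj_continuous.
by move/continuousP: cpr => /(_ [set s] (discrete_open _)).
Qed.

(** Otherwise points outside U agree with x on ever longer prefixes; they converge coordinatewise to
    x, against the openness of U. *)
Lemma open_cylinder (U : set X) (x : X) : open U -> U x ->
  exists n, forall y, (forall i, (i < n)%N -> c y i = c x i) -> U y.
Proof.
move=> [W oW <-] /= Wx; apply: contrapT => nU.
have /choice[y hy] : forall n, exists y : X,
    (forall i, (i < n)%N -> c y i = c x i) /\ ~ W (set_val y).
  move=> n; apply: contrapT => h; apply: nU; exists n => y yx.
  by apply: contrapT => nW; apply: h; exists y.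
pose z n : prod_topology (fun=> discrete_topology S) := set_val (y n).
have : z @ \oo --> (set_val x : prod_topology (fun=> discrete_topology S)).
  apply/cvg_sup => i B [_ [[V _ <-] /= Vx] VB].
  exists i.+1 => // n /= iN; apply: VB => /=.
  by have := (hy n).1 i iN; rewrite /tms_coord /z /proj => ->.
move=> /(_ W (open_nbhs_nbhs (conj oW Wx)))[n _ /(_ n (leqnn n))].
exact: (hy n).2.
Qed.

(** An open set is the union of the cylinders that it contains, and there are only countably many
    cylinders, since finite words over S are countable. *)
Lemma borel_ind (x0 : X) (G : set (set X)) : sigma_algebra setT G ->
  (forall i s, G [set x | c x i = s]) ->
  forall B : set (borel x0), measurable B -> G B.
Proof.
move=> [G0 GC GU] Gc; have GT : G setT.
  by rewrite -(setD0 setT); apply: GC.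
have GCc B : G B -> G (~` B) by move=> /GC; rewrite setTD.
have GI B D : G B -> G D -> G (B `&` D).
  move=> gB gD; rewrite -(setCK (B `&` D)) setCI; apply: (GCc).
  rewrite (_ : _ `|` _ = \bigcup_n (if n is 0%N then ~` B else ~` D)).
    by apply: GU => -[|n]; exact: GCc.
  apply/seteqP; split => x; first by case=> ?; [exists 0%N|exists 1%N].
  by move=> [[|n] _ ?]; [left|right].
have Gcyl (w : nat -> S) n : G [set x | forall i, (i < n)%N -> c x i = w i].
  elim: n => [|n IH]; first by rewrite (_ : [set x | _] = setT) //; apply/seteqP.
  rewrite (_ : [set x | _] =
    [set x | forall i, (i < n)%N -> c x i = w i] `&` [set x | c x n = w n]).
    exact: GI.
  apply/seteqP; split => x /=.
    by move=> h; split => [i ni|]; apply: h => //; rewrite ltnS ltnW.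
  by move=> [h1 h2] i; rewrite ltnS leq_eqVlt => /orP[/eqP->|/h1].
apply: smallest_sub; first by split.
move=> U oU; have [s0] : exists s : S, True by exists (c x0 0).
move=> _.
pose cyl (w : seq S) := [set x : X | forall i, (i < size w)%N -> c x i = nth s0 w i].
(* Words are enumerated by their codes; a code without a word, or with a cylinder that leaves U,
   contributes the empty set. *)
pose F n : set X := if @unpickle (seq S) n is Some w then
   (if `[< cyl w `<=` U >] then cyl w else set0) else set0.
rewrite (_ : U = \bigcup_n F n).
  apply: GU => n; rewrite /F; case: unpickle => // w.
  by case: ifP => // _; exact: Gcyl.
apply/seteqP; split => x.
  move=> Ux; have [n hn] := open_cylinder oU Ux.
  exists (pickle (mkseq (c x) n)) => //; rewrite /F pickleK ifT.
    by move=> i; rewrite size_mkseq => ni; rewrite nth_mkseq.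
  apply/asboolP => y yc; apply: hn => i ni.
  by rewrite yc ?size_mkseq // nth_mkseq.
move=> [n _]; rewrite /F; case: unpickle => // w; case: ifP => // /asboolP; exact.
Qed.

Variable x0 : X.

Lemma measurable_coord i s : measurable ([set x | c x i = s] : set (borel x0)).
Proof. by apply: sub_sigma_algebra; exact: coord_open. Qed.

Lemma tms_measurable_fun d (Y : measurableType d) (f : Y -> borel x0) :
  (forall i s, measurable [set y | c (f y) i = s]) -> measurable_fun setT f.
Proof.
move=> h _ B mB; rewrite setTI.
apply: (@borel_ind x0 [set B | measurable (f @^-1` B)]) mB; last exact: h.
split => [|D mD|F mF] /=; first by rewrite preimage_set0.
  by rewrite setTD -preimage_setC; apply: measurableC.
by rewrite preimage_bigcup; apply: bigcup_measurable => n _; exact: mF.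
Qed.

Lemma measurable_shift : measurable_fun setT (T : borel x0 -> borel x0).
Proof.
apply: tms_measurable_fun => i s.
by rewrite (_ : [set y | _] = [set x | c x i.+1 = s]) //; exact: measurable_coord.
Qed.

Lemma continuous_measurable (R : realType) (phi : X -> R) : continuous phi ->
  measurable_fun setT (phi : borel x0 -> R).
Proof.
move=> /continuousP cphi; apply: (measurability _ (RGenOpens.measurableE R)).
move=> _ [_ [a [b ->] <-]]; rewrite setTI; apply: sub_sigma_algebra.
exact/cphi/interval_open.
Qed.

Lemma measurable_coord_pre i (Q : set S) :
  measurable ([set x | Q (c x i)] : set (borel x0)).
Proof.
rewrite (_ : [set x | _] = \bigcup_n (if @unpickle S n is Some s then
   [set x : X | c x i = s /\ Q s] else set0)).
  apply: bigcup_measurable => n _; case: unpickle => // s.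
  have [Qs|nQ] := pselect (Q s).
    rewrite (_ : [set x | _] = [set x | c x i = s]); first exact: measurable_coord.
    by apply/seteqP; split => x /=; [case|split].
  by rewrite (_ : [set x | _] = set0) //; apply/seteqP; split => x [].
apply/seteqP; split => x /=; first by exists (pickle (c x i)); rewrite ?pickleK.
by move=> [n _]; case: unpickle => // s [->].
Qed.

Lemma fmeas_letter m : fmeas (letter m : borel x0 -> _).
Proof. by move=> j; exact: (measurable_coord_pre 0 [set s | inord (minn (pickle s) m) = j]). Qed.

Lemma fmeas_word m L : fmeas (letter_word m L : borel x0 -> _).
Proof. by apply: fmeas_process; [exact: measurable_shift|exact: fmeas_letter]. Qed.

End tms_borel.

(** * Approximation of finite-valued maps by windows *)

Section approximation.
Context {S : countType} {A : rel S} {R : realType}.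
Local Notation X := (tms A).
Local Notation T := (@tms_shift S A).
Local Notation c := (@tms_coord S A).
Variables (x0 : X) (mu : probability (borel x0) R).

(** m bounds both the number of letters and the retained alphabet, so that increasing one parameter
    refines both. *)
Definition window m (x : X) := letter_word m m x.

Lemma window_refine m m' : (m <= m')%N ->
  exists g : {ffun 'I_m' -> 'I_m'.+1} -> {ffun 'I_m -> 'I_m.+1},
    forall x, window m x = g (window m' x).
Proof.
move=> mm'; exists (fun w : {ffun 'I_m' -> 'I_m'.+1} =>
  [ffun i : 'I_m => inord (minn (w (widen_ord mm' i)) m) : 'I_m.+1]) => x.
apply/ffunP => i; rewrite !ffunE; apply: val_inj => /=.
rewrite !letterE !inordK ?ltnS ?geq_minr // -minnA.
by rewrite (minn_idPr mm').
Qed.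

Definition symdiff (B D : set X) : set X := (B `\` D) `|` (D `\` B).

Lemma measurable_symdiff (B D : set (borel x0)) : measurable B -> measurable D ->
  measurable (symdiff B D : set (borel x0)).
Proof. by move=> mB mD; apply: measurableU; apply: measurableD. Qed.

Lemma measurable_window m (E : set {ffun 'I_m -> 'I_m.+1}) :
  measurable (window m @^-1` E : set (borel x0)).
Proof. by apply: fmeas_pre; exact: fmeas_word. Qed.

(** The lower bound m0 on the window allows two approximations to be combined at the finer window,
    and later the window to be chosen after the tail estimate. *)
Definition approximable (B : set (borel x0)) := measurable B /\
  forall (e : R) m0, 0 < e -> exists m (E : set {ffun 'I_m -> 'I_m.+1}),
    (m0 <= m)%N /\ (mu (symdiff B (window m @^-1` E)) <= e%:E)%E.

Lemma approximableC B : approximable B -> approximable (~` B).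
Proof.
move=> [mB aB]; split; first exact: measurableC.
move=> e m0 e0; have [m [E [m0m le]]] := aB e m0 e0; exists m, (~` E); split => //.
apply: le_trans le; rewrite le_eqVlt; apply/orP; left; apply/eqP; congr (mu _).
apply/seteqP; split => x; rewrite /symdiff /=;
  have [Bx|nBx] := pselect (B x); have [Ex|nEx] := pselect (E (window m x)); tauto.
Qed.

Lemma approximableU B D : approximable B -> approximable D -> approximable (B `|` D).
Proof.
move=> [mB aB] [mD aD]; split; first exact: measurableU.
move=> e m0 e0; have e2 : 0 < e / 2 by rewrite divr_gt0.
have [m [E [m0m leE]]] := aB _ m0 e2; have [m' [E' [mm' leE']]] := aD _ m e2.
have [g hg] := window_refine mm'.
exists m', (g @^-1` E `|` E'); split; first exact: leq_trans mm'.
have -> : window m' @^-1` (g @^-1` E `|` E') = window m @^-1` E `|` window m' @^-1` E'.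
  by apply/seteqP; split => x /=; rewrite hg.
apply: (@le_trans _ _ (mu (symdiff B (window m @^-1` E) `|` symdiff D (window m' @^-1` E')))).
  apply: le_measure; rewrite ?inE.
  - apply: measurable_symdiff; first exact: measurableU.
    by apply: measurableU; exact: measurable_window.
  - by apply: measurableU; apply: measurable_symdiff => //; exact: measurable_window.
  - by move=> x; rewrite /symdiff /=; tauto.
apply: (@le_trans _ _ (mu (symdiff B (window m @^-1` E)) +
   mu (symdiff D (window m' @^-1` E')))%E).
  by apply: measureU2; apply: measurable_symdiff => //; exact: measurable_window.
by rewrite [e]splitr EFinD; apply: leeD.
Qed.

Lemma approximable_set0 : approximable set0.
Proof.
split=> // e m0 e0; exists m0, set0; split => //.
rewrite (_ : symdiff _ _ = set0) ?measure0 ?lee_fin ?ltW //.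
by apply/seteqP; split => x; rewrite /symdiff /=; tauto.
Qed.

(** By continuity from below a finite union misses at most e / 2 of the mass of the whole union, and
    it is itself approximable up to e / 2. *)
Lemma approximable_bigcup (F : nat -> set (borel x0)) :
  (forall n, approximable (F n)) -> approximable (\bigcup_n F n).
Proof.
move=> aF; split; first by apply: bigcup_measurable => n _; exact: (aF n).1.
move=> e m0 e0; have e2 : 0 < e / 2 by rewrite divr_gt0.
pose U n := \big[setU/set0]_(i < n) F i.
have aU n : approximable (U n).
  rewrite /U; elim: n => [|n IH]; first by rewrite big_ord0; exact: approximable_set0.
  by rewrite big_ord_recr; exact: approximableU.
have UE : \bigcup_n F n = \bigcup_n U n.
  apply/seteqP; split => x [n _ Fx].
    by exists n.+1 => //; rewrite /U big_ord_recr /=; right.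
  by move: Fx; rewrite /U -bigcup_mkord => -[i _ Fi]; exists i.
have mbU : measurable (\bigcup_n U n).
  by apply: bigcup_measurable => n _; exact: (aU n).1.
have ndU : nondecreasing_seq U.
  by move=> n m nm; rewrite /U; apply/subsetPset; exact: subset_bigsetU.
have cv := nondecreasing_cvg_mu (fun n => (aU n).1) mbU ndU.
have [n hn] : exists n, (mu ((\bigcup_n U n) `\` U n) <= (e / 2)%:E)%E.
  have fin : mu (\bigcup_n U n) \is a fin_num by exact: fin_num_measure.
  have /fine_cvgP[_ /cvgrPdist_le/(_ _ e2)[n _ /(_ n (leqnn n))]] :
      mu \o U @ \oo --> (fine (mu (\bigcup_n U n)))%:E
    by rewrite (fineK fin); exact: cv.
  move=> h; exists n; have mUn := (aU n).1.
  have sub : U n `<=` \bigcup_n U n by move=> x Ux; exists n.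
  rewrite measureD //; last by rewrite ltey_eq fin.
  rewrite (setIidr sub).
  have fin' : mu (U n) \is a fin_num by exact: fin_num_measure.
  rewrite -[X in (X - _)%E](fineK fin) -[X in (_ - X)%E](fineK fin') -EFinB lee_fin.
  by apply: le_trans h; rewrite ler_norm.
have [m [E [m0m leE]]] := (aU n).2 _ m0 e2; exists m, E; split => //.
rewrite UE.
apply: (@le_trans _ _ (mu ((\bigcup_n U n) `\` U n `|` symdiff (U n) (window m @^-1` E)))).
  apply: le_measure; rewrite ?inE.
  - by apply: measurable_symdiff => //; exact: measurable_window.
  - apply: measurableU; first by apply: measurableD => //; exact: (aU n).1.
    by apply: measurable_symdiff; [exact: (aU n).1|exact: measurable_window].
  - move=> x; rewrite /symdiff /=; have [Ux|nUx] := pselect (U n x).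
      move=> [[_ nE]|[Ex nU]]; first by right; left.
      by exfalso; apply: nU; exists n.
    by move=> [[bU nE]|[Ex nU]]; [left|right; right].
apply: (@le_trans _ _ (mu ((\bigcup_n U n) `\` U n) +
   mu (symdiff (U n) (window m @^-1` E)))%E).
  apply: measureU2; first by apply: measurableD => //; exact: (aU n).1.
  by apply: measurable_symdiff; [exact: (aU n).1|exact: measurable_window].
by rewrite [e]splitr EFinD; apply: leeD.
Qed.

Lemma measurable_approximable (B : set (borel x0)) : measurable B -> approximable B.
Proof.
apply: borel_ind.
  split; first exact: approximable_set0.
    by move=> D; rewrite setTD; exact: approximableC.
  exact: approximable_bigcup.
move=> i s; split; first exact: measurable_coord.
(* With m > i and m > pickle s the window decides exactly whether x_i = s. *)
move=> e m0 e0; pose m := (m0 + i.+1 + (pickle s).+1)%N.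
have im : (i < m)%N by rewrite /m; lia.
exists m, [set w | w (Ordinal im) = inord (pickle s)]; split; first by rewrite /m; lia.
rewrite (_ : symdiff _ _ = set0) ?measure0 ?lee_fin ?ltW //.
have key x : (window m x (Ordinal im) = inord (pickle s)) <-> c x i = s.
  rewrite ffunE /=; have sm : (pickle s < m)%N by rewrite /m; lia.
  split=> [|cs].
    move=> /(congr1 (@nat_of_ord _)); rewrite letterE inordK ?ltnS ?(ltnW sm) //.
    rewrite coord_iter addn0 => h; apply: (pcan_inj pickleK).
    by move: h; rewrite minnC /minn; case: ifP => //; lia.
  apply: val_inj; rewrite /= letterE coord_iter addn0 cs inordK ?ltnS ?(ltnW sm) //.
  by rewrite (minn_idPl (ltnW sm)).
apply/seteqP; split => x //; rewrite /symdiff /=; have := key x; tauto.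
Qed.

(** Each fibre of Y is approximated up to e / k, at a common window size. Off the union of the
    symmetric differences exactly one approximating set contains the window, and [rho] returns its
    index; on that union any value will do. *)
Lemma fmeas_approx (k : nat) (Y : borel x0 -> 'I_k) (e : R) (m0 : nat) :
  fmeas Y -> 0 < e -> exists m (rho : {ffun 'I_m -> 'I_m.+1} -> 'I_k), (m0 <= m)%N /\
    (mu [set x | Y x != rho (window m x)] <= e%:E)%E.
Proof.
move=> mY e0; have k0 : (0 < k)%N by apply: leq_trans (ltn_ord (Y x0)).
have ek : 0 < e / k%:R by rewrite divr_gt0 ?ltr0n.
have /choice[f hf] : forall q : 'I_k, exists mE : {m & set {ffun 'I_m -> 'I_m.+1}},
    (m0 <= projT1 mE)%N /\
    (mu (symdiff (Y @^-1` [set q]) (window (projT1 mE) @^-1` projT2 mE)) <= (e / k%:R)%:E)%E.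
  move=> q; have [_ /(_ _ m0 ek)[m [E h]]] := measurable_approximable (mY q).
  by exists (existT _ m E).
pose m := (m0 + \sum_(q < k) projT1 (f q))%N.
have fm q : (projT1 (f q) <= m)%N.
  by rewrite /m (bigD1 q) //= addnCA leq_addr.
have /choice[E hE] : forall q, exists E : set {ffun 'I_m -> 'I_m.+1},
    window (projT1 (f q)) @^-1` projT2 (f q) = window m @^-1` E.
  move=> q; have [g hg] := window_refine (fm q); exists (g @^-1` projT2 (f q)).
  by apply/seteqP; split => x /=; rewrite hg.
pose rho w := odflt (Y x0) [pick q : 'I_k | `[< E q w >]].
exists m, rho; split; first by rewrite leq_addr.
pose D q := symdiff (Y @^-1` [set q]) (window m @^-1` E q).
have mD q : measurable (D q : set (borel x0)).
  by apply: measurable_symdiff; [exact: mY|exact: measurable_window].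
have sub : [set x | Y x != rho (window m x)] `<=` \big[setU/set0]_(q < k) D q.
  move=> x /= /eqP nY; apply: contrapT => nD.
  have h q : (Y x = q) <-> E q (window m x).
    apply: contrapT => nq; apply: nD; rewrite (bigD1 q) //=; left; rewrite /D /symdiff /=.
    have [Eq|nEq] := pselect (E q (window m x)); have [Yq|nYq] := pselect (Y x = q); tauto.
  apply: nY; rewrite /rho; case: pickP => [q /asboolP/h //|/(_ (Y x))/asboolP].
  by rewrite -h.
apply: (@le_trans _ _ (mu (\big[setU/set0]_(q < k) D q))).
  apply: le_measure; rewrite ?inE //; last exact: bigsetU_measurable.
  have := @fmeas_pre _ _ _ (fun x : borel x0 => (Y x, window m x))
    [set p | p.1 != rho p.2].
  by apply; apply: fmeas_pair => //; exact: fmeas_word.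
apply: (@le_trans _ _ (\sum_(q < k) mu (D q))%E).
  suff [] : measurable (\big[setU/set0]_(q < k) D q : set (borel x0)) /\
    (mu (\big[setU/set0]_(q < k) D q) <= \sum_(q < k) mu (D q))%E by [].
  elim/big_rec2: _ => [|q r B _ [mB le]]; first by rewrite measure0.
  split; first exact: measurableU.
  have h : (mu (D q `|` B) <= mu (D q) + mu B)%E by exact: measureU2.
  by apply: (le_trans h); exact: leeD2l.
apply: (@le_trans _ _ (\sum_(q < k) (e / k%:R)%:E)%E).
  by apply: lee_sum => q _; have [_] := hf q; rewrite hE.
rewrite sumEFin sumr_const card_ord lee_fin -[leLHS]mulr_natr divfK // pnatr_eq0 -lt0n //.
Qed.

End approximation.

(** * Upper bound for the free energies *)

Section invariant_integral.
Context {R : realType} {d : measure_display} {T : measurableType d}.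
Variables (mu : probability T R) (f : T -> T).
Hypothesis mf : measurable_fun setT f.
Hypothesis f_inv : measure_invariant mu f.

Lemma integral_invariant i (g : T -> R) : mu.-integrable setT (EFin \o g) ->
  mu.-integrable setT (fun x => (g (iter i f x))%:E) /\
  (\int[mu]_x (g (iter i f x))%:E = \int[mu]_x (g x)%:E)%E.
Proof.
move=> ig; have mi : measurable_fun setT (iter i f) by exact: measurable_iter.
pose h : {mfun T >-> T} := HB.pack (iter i f) (isMeasurableFun.Build _ _ _ _ _ mi).
have eqm B : measurable B -> B `<=` setT -> pushforward mu h B = mu B.
  by move=> mB _; exact: invariant_iter.
have mg : measurable_fun setT (EFin \o g) by exact: measurable_int ig.
have inth : mu.-integrable setT ((EFin \o g) \o h).
  apply/integrableP; split; first exact: measurableT_comp.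
  have /integrableP[_] := ig; apply: le_lt_trans.
  rewrite -[leRHS](eq_measure_integral mu eqm).
  by rewrite ge0_integral_pushforward //; exact: measurableT_comp.
split; first exact: inth.
rewrite -[RHS](eq_measure_integral mu eqm).
by rewrite integral_pushforward.
Qed.

Lemma integral_birkhoff n (g : T -> R) : mu.-integrable setT (EFin \o g) ->
  mu.-integrable setT (fun x => (birkhoff f g n x)%:E) /\
  (\int[mu]_x (birkhoff f g n x)%:E = n%:R%:E * \int[mu]_x (g x)%:E)%E.
Proof.
move=> ig; have E : (fun x => (birkhoff f g n x)%:E) =
   (fun x => \sum_(i <- index_enum 'I_n) (g (iter i f x))%:E)%E.
  by apply/funext => x; rewrite /birkhoff sumEFin.
rewrite E; split.
  by apply: integrable_sum => // i _; exact: (integral_invariant i ig).1.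
rewrite integral_sum //; last by move=> i; exact: (integral_invariant i ig).1.
under eq_bigr do rewrite (integral_invariant _ ig).2.
have fin : (\int[mu]_x (g x)%:E)%E \is a fin_num by exact: integrable_fin_num.
by rewrite -(fineK fin) sumEFin sumr_const card_ord -EFinM mulr_natl.
Qed.

End invariant_integral.

(** Linear growth beats logarithmic growth: were z > 0, exponentiating would give (n z / 3)^3 <=
    e^(n z) <= B n^2 for all n >= 1. *)
Lemma le0_of_log_growth (R : realType) (z K : R) (m : nat) :
  (forall n, (0 < n)%N -> n%:R * z <= ln ((n + m) * (n + m)).+1%:R + K) -> z <= 0.
Proof.
move=> h; rewrite leNgt; apply/negP => z0.
pose B := (m.+2 * m.+2)%:R * expR K : R.
have key n : (0 < n)%N -> n%:R * (z / 3) ^+ 3 <= B.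
  move=> n0; have nR : 0 < n%:R :> R by rewrite ltr0n.
  have hz : 0 <= n%:R * (z / 3) by rewrite mulr_ge0 ?ltW // divr_gt0.
  have h1 : (n%:R * (z / 3)) ^+ 3 <= expR (n%:R * z).
    have -> : n%:R * z = n%:R * (z / 3) + n%:R * (z / 3) + n%:R * (z / 3) by field.
    move: hz; set y := n%:R * (z / 3) => hz.
    have e1 : y <= expR y by apply: le_trans (expR_ge1Dx _); rewrite lerDr.
    rewrite !expRD !exprS expr0 mulr1 mulrA.
    by apply: ler_pM => //; [exact: mulr_ge0|exact: ler_pM].
  have h2 : expR (n%:R * z) <= ((n + m) * (n + m)).+1%:R * expR K.
    have := h n n0; rewrite -ler_expR expRD lnK //.
    by rewrite posrE ltr0n.
  have h3 : (((n + m) * (n + m)).+1 <= n * n * (m.+2 * m.+2))%N by nia.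
  have h4 : n%:R ^+ 3 * (z / 3) ^+ 3 <= n%:R ^+ 2 * B.
    rewrite -exprMn; apply: (le_trans h1); apply: (le_trans h2).
    rewrite /B mulrA; apply: ler_wpM2r; first exact: expR_ge0.
    by rewrite -natrX -natrM ler_nat -mulnn.
  have n2 : 0 < n%:R ^+ 2 :> R by rewrite exprn_gt0.
  by rewrite -(ler_pM2l n2) mulrA -exprSr.
have z3 : 0 < (z / 3) ^+ 3 by rewrite exprn_gt0 // divr_gt0.
have := unstable.ltr_bound (B / (z / 3) ^+ 3).
rewrite ltr_pdivrMr // => lt.
have := key (Num.bound (B / (z / 3) ^+ 3)).+1 isT.
rewrite -natr1 mulrDl; lra.
Qed.

Lemma ln_prod (R : realType) (I : finType) (f : I -> R) : (forall i, 0 < f i) ->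
  ln (\prod_i f i) = \sum_i ln (f i).
Proof.
move=> f0; suff [] : 0 < \prod_i f i /\ ln (\prod_i f i) = \sum_i ln (f i) by [].
elim/big_rec2: _ => [|i s p _ [p0 ps]]; first by rewrite ln1.
by split; [exact: mulr_gt0|rewrite lnM ?posrE // ps].
Qed.

Section upper.
Context {S : countType} {A : rel S} {R : realType} (phi : tms A -> R) (a : S).
Local Notation X := (tms A).
Local Notation T := (@tms_shift S A).
Local Notation c := (@tms_coord S A).
Local Notation sphi := (birkhoff T phi).

Variable C : R.
Hypothesis distC : forall n x y, (forall i, (i <= n)%N -> c x i = c y i) ->
  `|sphi n x - sphi n y| <= C.
Hypothesis mixA : topologically_mixing A.
Variable P : R.
Hypothesis PE : gurevich_pressure phi a = P%:E.
Variable M : R.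
Hypothesis phiM : forall x, phi x <= M.
Hypothesis PM : P <= M.

Variables (x0 : X) (mu : probability (borel x0) R).
Hypothesis mu_inv : measure_invariant mu T.
Hypothesis phi_int : mu.-integrable setT (fun x => (phi x)%:E).

(** The sets decrease to the empty set because every state has a finite code; continuity from above
    applies. *)
Lemma letter_tail (e : R) : 0 < e -> exists m0, forall m, (m0 <= m)%N ->
  fine (mu [set x : X | ~~ (letter m x < m)%N]) <= e.
Proof.
move=> e0; pose F m : set (borel x0) := [set x : X | ~~ (letter m x < m)%N].
have FE m : F m = [set x : X | [set s : S | (m <= pickle s)%N] (c x 0)].
  by apply/seteqP; split => x /=; rewrite /F /= letter_lt -leqNgt.
have mF m : measurable (F m) by rewrite FE; exact: measurable_coord_pre.
have mb : measurable (\bigcap_n F n) by exact: bigcapT_measurable.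
have b0 : \bigcap_n F n = set0.
  apply/seteqP; split => x // /(_ (pickle (c x 0)).+1 Logic.I).
  by rewrite FE /= ltnn.
have dec : nonincreasing_seq F.
  move=> m n mn; apply/subsetPset => x; rewrite !FE /=; exact: leq_trans.
have fin0 : (mu (F 0%N) < +oo)%E by rewrite ltey_eq fin_num_measure.
have := nonincreasing_cvg_mu fin0 mF mb dec; rewrite b0 measure0 => cv.
have /fine_cvgP[_ /cvgrPdist_le/(_ _ e0)[m0 _ h]] : mu \o F @ \oo --> 0%:E by exact: cv.
exists m0 => m /h; rewrite sub0r normrN; apply: le_trans; exact: ler_norm.
Qed.

Lemma measurable_miss (k : nat) (Y : borel x0 -> 'I_k) (m : nat)
    (rho : {ffun 'I_m -> 'I_m.+1} -> 'I_k) : fmeas Y ->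
  measurable ([set x : X | Y x != rho (window m x)] : set (borel x0)).
Proof.
move=> mY; have := @fmeas_pre _ (borel x0) _ (fun x : borel x0 => (Y x, window m x))
    [set p | p.1 != rho p.2].
by apply; apply: fmeas_pair => //; exact: fmeas_word.
Qed.

(** [shannon_weight] for the pair of name and lumped word. The total weight gives the logarithm and
    the term in P; by invariance the mean number of lumped letters is at most L eps, and that of
    wrong predictions at most n eta. *)
Lemma entropy_step (k : nat) (Y : borel x0 -> 'I_k) (m : nat)
    (rho : {ffun 'I_m -> 'I_m.+1} -> 'I_k) (dl eps eta : R) : fmeas Y ->
  0 < dl -> dl < 1 ->
  fine (mu [set x : X | ~~ (letter m x < m)%N]) <= eps ->
  fine (mu [set x : X | Y x != rho (window m x)]) <= eta ->
  exists K, forall n,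
   shannon (law mu (process T Y n)) <=
     ln ((n + m) * (n + m)).+1%:R + K + (n + m)%:R * (P - fine (\int[mu]_x (phi x)%:E)
        + (M - P) * eps) + n%:R * (- ln (1 - dl) + `|ln (dl / k%:R)| * eta).
Proof.
move=> mY dl0 dl1 heps heta.
have k0 : (0 < k)%N by apply: leq_trans (ltn_ord (Y x0)).
have [K hK] := cover_weights distC mixA PE phiM PM m.
exists (K + (M - P) + 1) => n; pose L := (n + m)%N.
have [W [W0 Wpos Wle Wsum]] := hK L.
pose I := fine (\int[mu]_x (phi x)%:E).
(* The noise dl / k keeps every factor positive: a correct prediction costs at most - ln (1 - dl),
   and a wrong one adds at most b. *)
pose kap (q r : 'I_k) : R := (1 - dl) * (q == r)%:R + dl / k%:R.
have kap_pos q r : 0 < kap q r.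
  rewrite /kap ltr_wpDl ?divr_gt0 ?ltr0n // mulr_ge0 // subr_ge0 ltW //.
have kap_sum r : \sum_q kap q r = 1.
  rewrite /kap big_split /= -mulr_sumr (bigD1 r) //= eqxx big1 ?addr0; last first.
    by move=> q /negbTE ->.
  rewrite sumr_const card_ord -[X in _ + X]mulr_natr divfK ?pnatr_eq0 -?lt0n //.
  by rewrite mulr1 subrK.
pose b := `|ln (dl / k%:R)|.
have kap_ln q r : ln (1 - dl) - b * (q != r)%:R <= ln (kap q r).
  have dk : 0 < dl / k%:R by rewrite divr_gt0 ?ltr0n.
  have l1 : ln (1 - dl) <= 0 by apply: ln_le0; lra.
  rewrite /kap; case: eqVneq => _ /=; rewrite ?mulr0 ?mulr1 ?subr0 ?add0r.
    by rewrite ler_ln ?posrE; lra.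
  have := ler_norm (- ln (dl / k%:R)); rewrite normrN -/b; lra.
(* The n letters of the name are predicted from windows of length m, hence the word length n + m. *)
have sub_lt (t : 'I_n) (s : 'I_m) : (t + s < L)%N.
  by rewrite /L; have := ltn_ord t; have := ltn_ord s; lia.
pose sub (w : {ffun 'I_L -> 'I_m.+1}) (t : 'I_n) : {ffun 'I_m -> 'I_m.+1} :=
  [ffun s : 'I_m => w (Ordinal (sub_lt t s))].
have subE (x : X) (t : 'I_n) : sub (@letter_word S A m L x) t = window m (iter t T x).
  by apply/ffunP => s; rewrite !ffunE /= addnC iterD.
pose V (x : borel x0) := (process T Y n x, @letter_word S A m L x).
have mT : measurable_fun setT (T : borel x0 -> borel x0) by exact: measurable_shift.
have mV : fmeas V.
  by apply: fmeas_pair; [exact: (fmeas_process mT)|exact: fmeas_word].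
pose name := ({ffun 'I_n -> 'I_k} * {ffun 'I_L -> 'I_m.+1})%type.
pose w (v : name) : R :=
  W v.2 * \prod_(t < n) kap (v.1 t) (rho (sub v.2 t)).
have w0 v : 0 <= w v by rewrite /w mulr_ge0 // prodr_ge0 // => *; exact: ltW.
have wpos x : 0 < w (V x) by rewrite /w mulr_gt0 //= ?Wpos // prodr_gt0.
have lawV v : law mu V v != 0 -> w v != 0.
  apply: contra_neq => wv; rewrite /law (_ : V @^-1` _ = set0) ?measure0 //.
  by apply/seteqP; split => x //= Vx; have := wpos x; rewrite Vx wv ltxx.
have h1 : shannon (law mu (process T Y n)) <= shannon (law mu V).
  exact: (shannon_comp mu fst mV).
have h2 := shannon_weight (law_ge0 mu V) (law_sum mu mV) w0 lawV.
(* Each kernel [kap] sums to 1, so summing out the names leaves the sum of W. *)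
have h3 : \sum_v w v = \sum_c W c.
  rewrite -(pair_big predT predT (fun q c => w (q, c))) /= exchange_big /=.
  apply: eq_bigr => c _; rewrite /w /= -mulr_sumr.
  rewrite -(bigA_distr_bigA (fun (t : 'I_n) q => kap q (rho (sub c t)))) big1 ?mulr1 //.
have h4 : ln (\sum_v w v) <= ln (L * L).+1%:R + (K + L%:R * P).
  rewrite h3 -[K + _](expRK) -lnM ?posrE ?expR_gt0 ?ltr0n // ler_ln ?posrE //.
    by rewrite -h3 (bigD1 (V x0)) //= ltr_pwDl // sumr_ge0.
  by rewrite mulr_gt0 ?expR_gt0 ?ltr0n.
pose miss (v : name) : R :=
  \sum_(t < n) (v.1 t != rho (sub v.2 t))%:R.
(* [g] is a function of the finite-valued V that dominates [sphi L] pointwise, so its mean bounds L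
   times the integral of phi. *)
pose g (v : name) : R :=
  ln (w v) + (M - P) * (1 + (@outside m L v.2)%:R) + 1 - n%:R * ln (1 - dl) + b * miss v.
have h5 x : sphi L x <= g (V x).
  have := Wle x; rewrite /g /w lnM ?posrE ?Wpos ?prodr_gt0 // ln_prod //=.
  have : n%:R * ln (1 - dl) - b * miss (V x) <=
     \sum_(t < n) ln (kap (process T Y n x t) (rho (sub (@letter_word S A m L x) t))).
    rewrite /miss mulr_sumr -[n in n%:R](card_ord n) -sum1_card natr_sum mulr_suml.
    rewrite -sumrB; apply: ler_sum => t _; rewrite mul1r; exact: kap_ln.
  lra.
have h6 : L%:R * I <= \sum_v law mu V v * g v.
  have [is_ es_] := integral_birkhoff mT mu_inv L phi_int.
  rewrite -lee_fin EFinM /I fineK; last exact: integrable_fin_num.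
  rewrite -es_ -(integral_fin mu g mV); apply: le_integral => //.
  - exact: integrable_fin.
  - by move=> x _; rewrite lee_fin.
have h7 : \sum_v law mu V v * (@outside m L v.2)%:R <= L%:R * eps.
  under eq_bigr do rewrite /outside natr_sum mulr_sumr.
  rewrite exchange_big /=; apply: (@le_trans _ _ (\sum_(t < L) eps)); last first.
    by rewrite sumr_const card_ord mulr_natl.
  apply: ler_sum => t _.
  rewrite (mean_setE mu (fun v : name => ~~ (v.2 t < m)%N) mV).
  apply: le_trans heps; rewrite le_eqVlt; apply/orP; left; apply/eqP; congr fine.
  have mbad : measurable ([set x : X | ~~ (letter m x < m)%N] : set (borel x0)).
    have := @fmeas_pre _ (borel x0) _ (letter m) [set j : 'I_m.+1 | ~~ (j < m)%N].
    by apply; exact: fmeas_letter.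
  rewrite -(invariant_iter mT mu_inv t mbad).
  by congr (mu _); apply/seteqP; split => x /=; rewrite ffunE.
have h8 : \sum_v law mu V v * miss v <= n%:R * eta.
  under eq_bigr do rewrite /miss mulr_sumr.
  rewrite exchange_big /=; apply: (@le_trans _ _ (\sum_(t < n) eta)); last first.
    by rewrite sumr_const card_ord mulr_natl.
  apply: ler_sum => t _.
  rewrite (mean_setE mu (fun v : name => v.1 t != rho (sub v.2 t)) mV).
  apply: le_trans heta; rewrite le_eqVlt; apply/orP; left; apply/eqP; congr fine.
  rewrite -(invariant_iter mT mu_inv t (measurable_miss rho mY)).
  by congr (mu _); apply/seteqP; split => x /=; rewrite subE ffunE.
have h9 : \sum_v law mu V v * g v = \sum_v law mu V v * ln (w v) +
    (M - P) * (1 + \sum_v law mu V v * (@outside m L v.2)%:R) + 1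
    - n%:R * ln (1 - dl) + b * \sum_v law mu V v * miss v.
  have e1 r : \sum_v law mu V v * r = r by rewrite -mulr_suml (law_sum mu mV) mul1r.
  rewrite /g; under eq_bigr do rewrite !mulrDr.
  rewrite !big_split /= !e1 mulrDr mulr1.
  have e2 (r : R) f : \sum_v law mu V v * (r * f v) = r * \sum_v law mu V v * f v.
    by rewrite mulr_sumr; apply: eq_bigr => v _; rewrite mulrCA.
  by rewrite !e2.
have h10 : (M - P) * \sum_v law mu V v * (@outside m L v.2)%:R <= (M - P) * (L%:R * eps).
  by rewrite ler_wpM2l // subr_ge0.
have h11 : b * \sum_v law mu V v * miss v <= b * (n%:R * eta)
  by rewrite ler_wpM2l /b ?normr_ge0.
rewrite -/L -/I -/b; move: h6; rewrite h9 => h6.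
have -> : L%:R * (P - I + (M - P) * eps) = L%:R * P - L%:R * I + (M - P) * (L%:R * eps) by ring.
have -> : n%:R * (- ln (1 - dl) + b * eta) = - (n%:R * ln (1 - dl)) + b * (n%:R * eta) by ring.
move: h6; rewrite mulrDr mulr1; lra.
Qed.

Lemma entropy_upper (k : nat) (Y : borel x0 -> 'I_k) : fmeas Y ->
  limn (fun n => n%:R^-1 * shannon (law mu (process T Y n))) <=
    P - fine (\int[mu]_x (phi x)%:E).
Proof.
move=> mY; set h := limn _; set I := fine _.
have mT : measurable_fun setT (T : borel x0 -> borel x0) by exact: measurable_shift.
have k0 : (0 < k)%N by apply: leq_trans (ltn_ord (Y x0)).
have hle n : (0 < n)%N -> n%:R * h <= shannon (law mu (process T Y n)).
  move=> n0; have [_ /(_ n n0)] := process_entropy_cvg mT mu_inv mY.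
  by rewrite -/h => le; rewrite mulrC -ler_pdivlMr ?ltr0n // mulrC.
(* Here n tends to infinity, by [le0_of_log_growth]. The window is taken beyond m0, so that the tail
   bound and the approximation hold for the same m. *)
have key dl eps eta : 0 < dl -> dl < 1 -> 0 < eps -> 0 < eta ->
  h <= P - I + (M - P) * eps + (- ln (1 - dl) + `|ln (dl / k%:R)| * eta).
  move=> dl0 dl1 eps0 eta0; have [m0 hm0] := letter_tail eps0.
  have [m [rho [m0m le]]] := fmeas_approx mu m0 mY eta0.
  have le' : fine (mu [set x : X | Y x != rho (window m x)]) <= eta.
    by rewrite -lee_fin prob_fineK //; exact: measurable_miss.
  have [K hK] := entropy_step mY dl0 dl1 (hm0 m m0m) le'.
  rewrite -subr_le0; set Q := P - I + (M - P) * eps; set B := - ln _ + _.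
  apply: (@le0_of_log_growth _ _ (K + m%:R * Q) m) => n n0.
  have := hK n; have := hle n n0; rewrite -/I -/Q -/B natrD mulrBr !mulrDr mulrDl.
  lra.
apply/ler_addgt0Pr => e e0.
(* Three errors of at most e / 3 each: dl <= 1 / 2 and dl <= e / 6 give - ln (1 - dl) <= dl / (1 -
   dl) <= 2 dl <= e / 3. This fixes b, and eta is chosen after it. *)
pose dl := Num.min (1 / 2) (e / 6).
have dl0 : 0 < dl by rewrite lt_min divr_gt0 // divr_gt0.
have dl2 : dl <= 1 / 2 by rewrite ge_min lexx.
have dle : dl <= e / 6 by rewrite ge_min lexx orbT.
have dl1 : dl < 1 by lra.
have e3 : 0 < e / 3 by rewrite divr_gt0.
have lndl : - ln (1 - dl) <= e / 3.
  have p1 : 0 < 1 - dl by lra.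
  rewrite -lnV ?posrE //.
  have -> : (1 - dl)^-1 = 1 + ((1 - dl)^-1 - 1) by rewrite addrCA subrr addr0.
  apply: (le_trans (le_ln1Dx _)).
    by rewrite ltrBrDr addrC subrr invr_gt0.
  have -> : (1 - dl)^-1 - 1 = dl / (1 - dl) by field; rewrite gt_eqF.
  by rewrite ler_pdivrMr //; nra.
pose b := `|ln (dl / k%:R)|.
have b0 : 0 <= b by rewrite /b normr_ge0.
have hMP : 0 <= M - P by rewrite subr_ge0.
have small (r : R) : 0 <= r -> r * (e / 3 / (r + 1)) <= e / 3.
  move=> r0; rewrite mulrCA -[leRHS]mulr1 (ler_wpM2l (ltW e3)) ?ler_pdivrMr; lra.
have pos (r : R) : 0 <= r -> 0 < e / 3 / (r + 1).
  by move=> r0; rewrite divr_gt0 //; lra.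
have := key dl (e / 3 / (M - P + 1)) (e / 3 / (b + 1)) dl0 dl1 (pos _ hMP) (pos _ b0).
have := small _ hMP; have := small _ b0; rewrite -/b; lra.
Qed.

End upper.

(** * Lower bound for the free energies *)

Section unit_interval.
Context {R : realType}.

Definition unit_itv : set (measurableTypeR R) := `[0, 1[%classic.

Lemma measurable_unit_itv : measurable unit_itv.
Proof. exact: measurable_itv. Qed.

Definition lebesgue01 : set (measurableTypeR R) -> \bar R :=
  mrestr lebesgue_measure measurable_unit_itv.

HB.instance Definition _ := Measure.on lebesgue01.

Lemma lebesgue01_setT : lebesgue01 setT = 1%E.
Proof.
rewrite /lebesgue01 /mrestr setTI /unit_itv lebesgue_measure_itv /= lte_fin ltr01.
by rewrite oppr0 adde0.
Qed.

HB.instance Definition _ :=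
  Measure_isProbability.Build _ _ _ lebesgue01 lebesgue01_setT.

Lemma measurable_affine (b p : R) :
  measurable_fun setT ((fun u => (u - b) / p) : measurableTypeR R -> measurableTypeR R).
Proof. by apply: measurable_funM => //; apply: measurable_funB. Qed.

(** The image of Lebesgue measure under the affine map, divided by p, agrees with Lebesgue measure
    on half-open intervals, which determine it. *)
Lemma lebesgue_affine (b p : R) (B : set (measurableTypeR R)) : 0 < p -> measurable B ->
  lebesgue_measure ((fun u => (u - b) / p) @^-1` B) = (p%:E * lebesgue_measure B)%E.
Proof.
move=> p0 mB.
have pi0 : 0 <= p^-1 by rewrite invr_ge0 ltW.
pose h : measurableTypeR R -> measurableTypeR R := fun u => (u - b) / p.
pose nu := pushforward (@lebesgue_measure R) h.
have mh : measurable_fun setT h by exact: measurable_affine.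
pose h' : {mfun measurableTypeR R >-> measurableTypeR R} :=
  HB.pack h (isMeasurableFun.Build _ _ _ _ h mh).
have -> := @lebesgue_measure_unique R
  (mscale (NngNum pi0) (pushforward lebesgue_measure h')) _ B mB.
  by rewrite /mscale /= muleA -EFinM divff ?gt_eqF // mul1e.
move=> _ [[x y]] _ <-.
have hE : h @^-1` `]x, y]%classic = `](b + p * x), (b + p * y)]%classic.
  apply/seteqP; split => u /=; rewrite !in_itv /= /h ltr_pdivlMr // ler_pdivrMr //;
    by move=> /andP[? ?]; apply/andP; split; lra.
transitivity (p^-1%:E * lebesgue_measure (h @^-1` `]x, y]%classic))%E; last by [].
rewrite hE.
rewrite !lebesgue_measure_itv /= !lte_fin ltrD2l ltr_pM2l //.
case: ifP => _; last by rewrite mule0.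
by rewrite -!EFinB -EFinM; congr (_%:E); field; rewrite gt_eqF.
Qed.

(* G is the piecewise affine expanding map of [0, 1[ with slopes 1 / p i and
   branches starting at cum i, and D picks the branch; hence the itinerary
   D, D o G, D o G^2, ... is independent with law p. *)
Lemma bernoulli_source (k : nat) (p : 'I_k -> R) :
  (forall i, 0 < p i) -> \sum_i p i = 1 ->
  exists (D : measurableTypeR R -> 'I_k) (G : measurableTypeR R -> measurableTypeR R),
    [/\ fmeas D, measurable_fun setT G &
      forall w B, measurable B ->
        lebesgue01 (D @^-1` [set w] `&` G @^-1` B) = ((p w)%:E * lebesgue01 B)%E].
Proof.
move=> p0 p1.
pose cum (j : nat) := \sum_(i < k | (i < j)%N) p i.
have cum0 : cum 0%N = 0 by rewrite /cum big_pred0.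
have cumk : cum k = 1 by rewrite /cum -p1; apply: eq_bigl => i; rewrite ltn_ord.
have cumS (w : 'I_k) : cum w.+1 = cum w + p w.
  rewrite /cum (bigD1 w) //= addrC; congr (_ + _); apply: eq_bigl => i.
  by rewrite ltnS [RHS]ltn_neqAle andbC.
have cum_le i j : (i <= j)%N -> cum i <= cum j.
  move=> ij; rewrite /cum [leRHS](bigID (fun l : 'I_k => (l < i)%N)) /=.
  have -> : \sum_(l < k | (l < j)%N && (l < i)%N) p l = \sum_(l < k | (l < i)%N) p l.
    by apply: eq_bigl => l; case: (ltnP l i) => [li|]; rewrite ?andbF // andbT (leq_trans li ij).
  by rewrite lerDl sumr_ge0 // => l _; exact: ltW.
pose h (w : 'I_k) (u : R) := (u - cum w) / p w.
have hE w u : (0 <= h w u < 1) = (cum w <= u < cum w.+1).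
  rewrite /h ler_pdivlMr // mul0r subr_ge0 ltr_pdivrMr // mul1r cumS.
  by rewrite ltrBlDl.
have h_inj w w' u : 0 <= h w u < 1 -> 0 <= h w' u < 1 -> w = w'.
  rewrite !hE => /andP[a1 a2] /andP[b1 b2]; apply: val_inj; apply/eqP.
  case: ltngtP => // [lt|lt]; have := cum_le _ _ lt; lra.
have h_ex u : 0 <= u < 1 -> exists w, 0 <= h w u < 1.
  move=> /andP[u0 u1].
  have ex : exists j, u < cum j by exists k; rewrite cumk.
  case: (ex_minnP ex) => -[|j] uj minj; first by move: uj; rewrite cum0; lra.
  have jk : (j < k)%N by apply: minj; rewrite cumk.
  exists (Ordinal jk); rewrite hE uj andbT leNgt; apply/negP => /minj.
  by rewrite ltnn.
have h_unit w u : 0 <= h w u < 1 -> 0 <= u < 1.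
  rewrite hE => /andP[a1 a2]; apply/andP; split.
    by apply: le_trans a1; rewrite -cum0; exact: cum_le.
  by apply: lt_le_trans a2 _; rewrite -cumk; apply: cum_le.
have [w0 _] := h_ex 0 (introT andP (conj (lexx 0) ltr01)).
pose b (w : 'I_k) (u : measurableTypeR R) := 0 <= h w u < 1.
(* D factors through the finite vector of branch tests, which makes it measurable; w0 is its value
   off [0, 1[, a null set. *)
pose pick_branch (c : {ffun 'I_k -> bool}) := odflt w0 [pick w | c w].
pose D u := pick_branch [ffun w => b w u].
have DE w u : 0 <= h w u < 1 -> D u = w.
  rewrite /D /pick_branch => hw; case: pickP => [w'|/(_ w)]; rewrite ffunE.
    by move=> hw'; exact: h_inj hw' hw.
  by rewrite /b hw.
have mh w : measurable_fun setT (h w : measurableTypeR R -> measurableTypeR R).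
  exact: measurable_affine.
have mb w : fmeas (b w).
  have mt : measurable (b w @^-1` [set true]).
    rewrite -[X in measurable X]setTI.
    have -> : b w @^-1` [set true] = h w @^-1` unit_itv.
      by apply/seteqP; split => u; rewrite /unit_itv /b /= in_itv.
    by apply: mh => //; exact: measurable_unit_itv.
  case=> //; rewrite (_ : _ @^-1` _ = ~` (b w @^-1` [set true])).
    exact: measurableC.
  by apply/seteqP; split => u /=; case: (b w u).
have mD : fmeas D.
  exact: (fmeas_comp pick_branch (fmeas_ffun mb)).
pose G (u : measurableTypeR R) : measurableTypeR R := h (D u) u.
exists D, G; split=> //.
  move=> _ B mB; rewrite setTI.
  have -> : G @^-1` B = \bigcup_(w in [set: 'I_k]) (D @^-1` [set w] `&` h w @^-1` B).
    apply/seteqP; split => u /=; first by move=> Gu; exists (D u).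
    by move=> [w _ [/= <-]].
  apply: fin_bigcup_measurable => [|w _]; first exact: finite_finset.
  apply: measurableI; first exact: mD.
  by rewrite -[X in measurable X]setTI; exact: mh.
(* On branch w the map G is the affine map [h w], so the set is the preimage under [h w] of the part
   of B in [0, 1[, whose measure is scaled by [p w]. *)
move=> w B mB; rewrite /lebesgue01 /mrestr -(lebesgue_affine (cum w)) //; last first.
  by apply: measurableI => //; exact: measurable_unit_itv.
congr (lebesgue_measure _); apply/seteqP; split => u; rewrite /unit_itv /= !in_itv /=.
  move=> [[<- GB] u01]; split => //; have [v hv] := h_ex _ u01.
  by rewrite -/(h _ _) (DE _ _ hv).
move=> [hB hw]; rewrite -/(h _ _) in hw hB; have Dw := DE _ _ hw.
by split; [split => //; rewrite /G Dw|exact: h_unit hw].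
Qed.

End unit_interval.

(** The existential form lets a whole family of image measures be chosen at once. *)
Lemma pushforward_measure (R : realType) (d d' : measure_display) (O : measurableType d)
    (U : measurableType d') (P : probability O R) (f : O -> U) :
  measurable_fun setT f ->
  exists nu : {measure set U -> \bar R}, (nu : set U -> \bar R) = pushforward P f.
Proof.
move=> mf; eexists (pushforward P f : {measure set U -> \bar R}); by [].
Unshelve. exact: mf.
Qed.

Section measure_probability.
Context {R : realType} {d : measure_display} {U : measurableType d}.
Variable m : {measure set U -> \bar R}.
Hypothesis m1 : m setT = 1%E.

(** The alias records the proof of total mass 1, so that a probability structure can be attached to
    m. *)
Definition unit_mass of m setT = 1%E : set U -> \bar R := m.

HB.instance Definition _ := Measure.on (unit_mass m1).

HB.instance Definition _ := Measure_isProbability.Build _ _ _ (unit_mass m1) m1.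

Lemma measure_probability : exists mu : probability U R, (mu : set U -> \bar R) = m.
Proof. by exists (unit_mass m1). Qed.

End measure_probability.

(** Meant for the maps T^i o pi with i < n: averaging over one period turns invariance under T^n
    into invariance under T. The integral formula is for nonnegative functions and so asks for no
    integrability. *)
Lemma average_probability (R : realType) (d d' : measure_display) (O : measurableType d)
    (U : measurableType d') (P : probability O R) (n : nat) (g : nat -> O -> U) :
  (0 < n)%N -> (forall i, measurable_fun setT (g i)) ->
  exists mu : probability U R,
    (forall B, measurable B -> mu B = (n%:R^-1%:E * \sum_(i < n) P (g i @^-1` B))%E) /\
    (forall f : U -> \bar R, measurable_fun setT f -> (forall x, 0 <= f x)%E ->
      (\int[mu]_x f x = n%:R^-1%:E * \sum_(i < n) \int[P]_u f (g i u))%E).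
Proof.
move=> n0 mg.
have inv0 : 0 <= n%:R^-1 :> R by rewrite invr_ge0 ler0n.
have /choice[nu hnu] : forall i, exists nu : {measure set U -> \bar R},
    (nu : set U -> \bar R) = pushforward P (g i).
  by move=> i; exact: pushforward_measure.
pose mu0 : {measure set U -> \bar R} := mscale (NngNum inv0) (msum nu n).
have mu0E B : mu0 B = (n%:R^-1%:E * \sum_(i < n) P (g i @^-1` B))%E.
  rewrite /mu0 /mscale /msum /=; congr (_ * _)%E; apply: eq_bigr => i _.
  by rewrite hnu.
have mu01 : mu0 setT = 1%E.
  rewrite mu0E; under eq_bigr do rewrite preimage_setT probability_setT.
  rewrite sumEFin sumr_const card_ord -EFinM mulVf // pnatr_eq0 -lt0n //.
have [mu muE] := measure_probability mu01.
exists mu; rewrite muE; split => // f mf f0.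
rewrite ge0_integral_mscale // ge0_integral_measure_sum //; congr (_ * _)%E.
by apply: eq_bigr => i _; rewrite hnu ge0_integral_pushforward // => x _.
Qed.

(** Z is a function of Y; [t0] supplies a value at the letters that Y never takes. *)
Lemma shannon_factor (R : realType) (d : measure_display) (T : measurableType d)
    (mu : probability T R) (J K : finType) (Y : T -> J) (Z : T -> K) (t0 : T) :
  fmeas Y -> (forall x y, Y x = Y y -> Z x = Z y) ->
  shannon (law mu Z) <= shannon (law mu Y).
Proof.
move=> mY YZ.
have /choice[g hg] : forall j, exists k, forall x, Y x = j -> Z x = k.
  move=> j; have [[x xj]|nx] := pselect (exists x, Y x = j).
    by exists (Z x) => y yj; apply: YZ; rewrite xj.
  by exists (Z t0) => x xj; exfalso; apply: nx; exists x.
have -> : Z = g \o Y by apply/funext => x; exact: hg.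
exact: shannon_comp.
Qed.

Lemma shannon_prod (R : realType) (J K : finType) (p : J -> R) (q : K -> R) :
  (forall j, 0 <= p j) -> (forall k, 0 <= q k) -> \sum_j p j = 1 -> \sum_k q k = 1 ->
  shannon (fun jk : J * K => p jk.1 * q jk.2) = shannon p + shannon q.
Proof.
move=> p0 q0 p1 q1; rewrite /shannon -opprD; congr (- _).
rewrite -(pair_big predT predT (fun j k => p j * q k * ln (p j * q k))) /=.
have E j k : p j * q k * ln (p j * q k) =
    q k * (p j * ln (p j)) + p j * (q k * ln (q k)).
  have [->|pj] := eqVneq (p j) 0; first by rewrite !(mul0r, mulr0, addr0).
  have [->|qk] := eqVneq (q k) 0; first by rewrite !(mul0r, mulr0, addr0).
  by rewrite lnM ?posrE ?lt_neqAle ?p0 ?q0 ?andbT 1?eq_sym //; ring.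
under eq_bigr do under eq_bigr do rewrite E.
under eq_bigr do rewrite big_split /= -mulr_suml q1 mul1r -mulr_sumr.
by rewrite big_split /= -mulr_suml p1 mul1r.
Qed.

Section bernoulli_shift.
Context {R : realType} {d : measure_display} {O : measurableType d}.
Variables (P : probability O R) (k : nat) (p : 'I_k -> R) (D : O -> 'I_k) (G : O -> O).
Hypothesis p0 : forall i, 0 < p i.
Hypothesis p1 : \sum_i p i = 1.
Hypothesis mD : fmeas D.
Hypothesis mG : measurable_fun setT G.
Hypothesis DG : forall w B, measurable B ->
  P (D @^-1` [set w] `&` G @^-1` B) = ((p w)%:E * P B)%E.

(** The independence relation is summed over the symbol w, the [p w] adding up to 1. *)
Lemma bernoulli_invariant : measure_invariant P G.
Proof.
move=> B mB; have mGB : measurable (G @^-1` B).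
  by rewrite -[X in measurable X]setTI; exact: mG.
have -> : G @^-1` B = \bigcup_(w in [set w : 'I_k | predT w]) (D @^-1` [set w] `&` G @^-1` B).
  apply/seteqP; split => u /=; first by move=> Gu; exists (D u).
  by move=> [w _ []].
rewrite measure_fin_bigcup //.
- rewrite -(@bigfs _ _ _ _ (index_enum 'I_k)) ?index_enum_uniq //; last first.
    by move=> j _; rewrite mem_index_enum.
  rewrite (eq_bigr (fun w => (p w)%:E * P B)%E); last by move=> w _; exact: DG.
  rewrite -ge0_sume_distrl => [|w _]; last by rewrite lee_fin ltW.
  by rewrite sumEFin p1 mul1e.
- exact: finite_finset.
- by move=> i j _ _ [u [[/= <- _] [/= <- _]]].
- by move=> w _; apply: measurableI.
Qed.

Lemma law_bernoulli : law P D = p.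
Proof.
apply/funext => w; rewrite /law; have := DG w measurableT.
by rewrite preimage_setT setIT probability_setT mule1 => ->.
Qed.

(** The first symbol is independent of the name of length q that follows it, so each step adds
    [shannon p]. *)
Lemma bernoulli_shannon q : q%:R * shannon p <= shannon (law P (process G D q)).
Proof.
have mproc m : fmeas (process G D m) by exact: fmeas_process.
elim: q => [|q IH]; first by rewrite mul0r; exact: shannon_law_ge0.
rewrite -[in leLHS]natr1 mulrDl mul1r.
pose Z u := (D u, process G D q (G u)).
have lZ : law P Z = (fun jk => p jk.1 * law P (process G D q) jk.2).
  apply/funext => -[j w]; rewrite /law /=; apply: EFin_inj.
  have mZ : fmeas Z.
    apply: fmeas_pair => // w'.
    exact: (measurable_iter_pre mG 1 (mproc q w')).
  rewrite prob_fineK; last exact: mZ.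
  rewrite EFinM prob_fineK; last exact: mproc.
  have <- := DG j (mproc q w); congr (P _).
  apply/seteqP; split => u /=; first by rewrite /Z => -[-> ->].
  by move=> [<- <-].
have := shannon_prod (fun j => ltW (p0 j)) (law_ge0 P (process G D q)) p1
  (law_sum P (mproc q)).
rewrite -lZ => hZ.
apply: (@le_trans _ _ (shannon (law P Z))); first by rewrite hZ addrC lerD2l.
pose g (w : {ffun 'I_q.+1 -> 'I_k}) := (w ord0, [ffun i : 'I_q => w (lift ord0 i)]).
have -> : Z = g \o process G D q.+1.
  apply/funext => u; rewrite /Z /g /=; congr (_, _); first by rewrite ffunE.
  by apply/ffunP => i; rewrite !ffunE /= -iterSr.
exact: shannon_comp.
Qed.

End bernoulli_shift.

Lemma fmeas_measurable_comp (d d' : measure_display) (T : measurableType d)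
    (U : measurableType d') (J : finType) (Y : U -> J) (g : T -> U) :
  measurable_fun setT g -> fmeas Y -> fmeas (Y \o g).
Proof.
by move=> mg mY j; have := mg measurableT _ (mY j); rewrite setTI.
Qed.

(** * Random concatenation of loops *)

Section lower.
Context {S : countType} {A : rel S} {R : realType} (phi : tms A -> R) (a : S).
Local Notation X := (tms A).
Local Notation T := (@tms_shift S A).
Local Notation c := (@tms_coord S A).
Local Notation sphi := (birkhoff T phi).

Variable C : R.
Hypothesis distC : forall n x y, (forall i, (i <= n)%N -> c x i = c y i) ->
  `|sphi n x - sphi n y| <= C.
Hypothesis phi_cont : continuous phi.
Variable M : R.
Hypothesis phiM : forall x, phi x <= M.

(** All loops start and end at a, so they can follow one another in any order. *)
Lemma concatenate (k n : nat) (xs : 'I_k -> X) : (0 < n)%N ->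
  (forall w, loops a n (xs w)) ->
  forall v : nat -> 'I_k, exists x : X, forall i, c x i = c (xs (v (i %/ n)%N)) (i %% n)%N.
Proof.
move=> n0 xl v; apply: tms_ex => i.
have := divn_eq i n; have := ltn_pmod i n0.
set q := (i %/ n)%N; set r := (i %% n)%N => rn iE.
have [r1|r1] := ltnP r.+1 n.
  have -> : (i.+1 %/ n = q)%N by rewrite iE -addnS divnMDl // divn_small // addn0.
  have -> : (i.+1 %% n = r.+1)%N by rewrite iE -addnS modnMDl modn_small.
  exact: tms_coordP.
have rE : r.+1 = n by apply/eqP; rewrite eqn_leq rn r1.
have -> : (i.+1 %% n = 0)%N by rewrite iE -addnS rE modnMDl modnn.
rewrite (xl _).2 -(loop_coord (xl (v q))) -rE; exact: tms_coordP.
Qed.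

Lemma lower_bound (n : nat) (s : seq X) (r : R) : (0 < n)%N -> uniq s ->
  {in s, forall x, loops a n x} ->
  expR (n%:R * r + 2 * C) < \sum_(x <- s) expR (sphi n x) ->
  exists2 e : \bar R, free_energies phi e & (r%:E <= e)%E.
Proof.
move=> n0 us sl hs.
have C0 : 0 <= C.
  have : s != [::].
    apply/eqP => s0; move: hs; rewrite s0 big_nil ltNge => /negP; apply.
    exact: expR_ge0.
  case: (s) => // x _ _; have := @distC 0 x x (fun _ _ => erefl).
  exact: le_trans.
have [x0 _] : exists x : X, True.
  case: s us sl hs => [|x s' *]; last by exists x.
  by rewrite big_nil ltNge expR_ge0.
pose k := size s; pose xs (w : 'I_k) := nth x0 s w.
have xs_in w : xs w \in s by exact: mem_nth.
have xl w : loops a n (xs w) by exact: sl.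
have xs_inj : injective xs.
  by move=> w w' /eqP; rewrite nth_uniq // => /eqP/val_inj.
pose Z := \sum_w expR (sphi n (xs w)).
have ZE : \sum_(x <- s) expR (sphi n x) = Z by rewrite (big_nth x0) big_mkord.
have Z0 : 0 < Z by rewrite -ZE; apply: lt_trans hs; exact: expR_gt0.
pose p w := expR (sphi n (xs w)) / Z.
have p0 w : 0 < p w by rewrite divr_gt0 // expR_gt0.
have p1 : \sum_w p w = 1 by rewrite -mulr_suml divff // gt_eqF.
(* The equality case of the finite variational principle: for these weights, entropy plus mean
   Birkhoff sum is exactly ln Z. *)
have Hp : shannon p = ln Z - \sum_w p w * sphi n (xs w).
  rewrite /shannon -[X in _ = X - _]mul1r -p1 mulr_suml -sumrB -sumrN.
  by apply: eq_bigr => w _; rewrite ln_div ?posrE ?expR_gt0 // expRK; ring.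
have [D [G [mD mG DG]]] := bernoulli_source p0 p1.
pose O := measurableTypeR R; pose P : probability O R := lebesgue01.
have /choice[pi piE] : forall u : O, exists x : X, forall i,
    c x i = c (xs (D (iter (i %/ n)%N G u))) (i %% n)%N.
  by move=> u; exact: (concatenate n0 xl (fun q => D (iter q G u))).
have piG u : iter n T (pi u) = pi (G u).
  apply: tms_ext => i; rewrite coord_iter !piE -{1}[n]mul1n divnMDl // add1n iterSr.
  by rewrite modnDl.
have block u t j : (j < n)%N -> c (pi u) (t * n + j) = c (xs (D (iter t G u))) j.
  by move=> jn; rewrite piE divnMDl // divn_small // addn0 modnMDl modn_small.
have mpi : measurable_fun setT (pi : O -> borel x0).
  apply: tms_measurable_fun => i b.
  have := @fmeas_pre _ _ _ (D \o iter (i %/ n) G) [set w | c (xs w) (i %% n)%N = b].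
  rewrite (_ : _ @^-1` _ = [set u | c (pi u) i = b]); first by apply; exact: fmeas_iter.
  by apply/seteqP; split => u /=; rewrite piE.
have mT : measurable_fun setT (T : borel x0 -> borel x0) by exact: measurable_shift.
pose g i : O -> borel x0 := fun u => iter i T (pi u).
have mg i : measurable_fun setT (g i).
  exact: (measurableT_comp (measurable_iter mT i) mpi).
have [mu [muE mu_int]] := average_probability P n0 mg.
have G_inv : measure_invariant P G by exact: bernoulli_invariant DG.
have mu_inv : measure_invariant mu T.
  move=> B mB.
  have mTB : measurable (T @^-1` B : set (borel x0)).
    by rewrite -[X in measurable X]setTI; exact: mT.
  rewrite !muE //; congr (_ * _)%E.
  have gS i : g i @^-1` (T @^-1` B) = g i.+1 @^-1` B by [].
  under eq_bigr do rewrite gS.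
  (* Applying T moves the average by one time step, so only the terms at times 0 and n have to be
     compared. *)
  have gn : P (g n @^-1` B) = P (g 0%N @^-1` B).
    have -> : g n @^-1` B = G @^-1` (g 0%N @^-1` B).
      by apply/seteqP; split => u; rewrite /g /= piG.
    by apply: G_inv; rewrite -[X in measurable X]setTI; exact: mg.
  case: (n) n0 gn => // n' _ gn.
  by rewrite big_ord_recr big_ord_recl /= gn addeC.
(* m exceeds the code of every state on the loops, so [letter m] distinguishes these states. *)
pose m := (\sum_(w < k) \sum_(j < n) (pickle (c (xs w) j)).+1)%N.
have xm w j : (j < n)%N -> (pickle (c (xs w) j) < m)%N.
  move=> jn; rewrite /m (bigD1 w) //= (bigD1 (Ordinal jn)) //=.
  by rewrite -addnA addSn ltnS leq_addr.
pose Y : borel x0 -> 'I_m.+1 := letter m.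
have mY : fmeas Y by exact: fmeas_letter.
pose H N := shannon (law mu (process T Y N)).
(* From any phase i < n, a stretch of length n (q + 1) contains the blocks 1 to q in full, and so
   determines q independent symbols. Concavity passes from the single phases to their average mu. *)
have Hq q : q%:R * shannon p <= H (n * q.+1)%N.
  set N := (n * q.+1)%N.
  have mN : fmeas (process T Y N : borel x0 -> _) by exact: fmeas_process.
  have mNg i : fmeas (process T Y N \o g i : O -> _) by exact: fmeas_measurable_comp.
  have hi i : (i < n)%N -> q%:R * shannon p <= shannon (law P (process T Y N \o g i)).
    move=> ni.
    have mp : fmeas (process G D q : O -> _) by exact: fmeas_process.
    apply: (le_trans (bernoulli_shannon p0 p1 mD mG DG q)).
    (* The phase may cut block 0, so the symbols are read from block 1 on; G preserves their law. *)
    rewrite -(law_iter mG G_inv 1 mp).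
    apply: (shannon_factor P 0) => [|u u' /ffunP uu']; first exact: mNg.
    apply/ffunP => t; rewrite !ffunE /= -!iterSr.
    apply: xs_inj; apply: (periodic_ext n0 (xl _).1 (xl _).1) => j jn.
    have jN : (t.+1 * n + j - i < N)%N.
      rewrite /N; have := ltn_ord t; nia.
    have := uu' (Ordinal jN); rewrite !ffunE /= -!iterD.
    have -> : (t.+1 * n + j - i + i = t.+1 * n + j)%N by rewrite subnK //; nia.
    move=> /letter_inj; rewrite letter_lt !coord_iter addn0 !block //; apply.
    exact: xm.
  have := @shannon_concave R _ n (fun i => law P (process T Y N \o g i))
    (law mu (process T Y N)).
  rewrite -/(H N) => le; apply: le_trans (le _ _ n0 _).
  - rewrite ler_pdivlMl ?ltr0n //; apply: (@le_trans _ _ (\sum_(i < n) q%:R * shannon p)).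
      by rewrite sumr_const card_ord -[leRHS]mulr_natl.
    by apply: ler_sum => i _; exact: hi.
  - by move=> i j; exact: law_ge0.
  - by move=> i; exact: law_sum.
  - move=> w; apply: EFin_inj; rewrite prob_fineK; last exact: mN.
    rewrite muE; last exact: mN.
    rewrite EFinM -sumEFin; congr (_ * _)%E; apply: eq_bigr => i _.
    by rewrite prob_fineK //; exact: mNg.
have [cvH _] := process_entropy_cvg mT mu_inv mY.
have [h hE] : exists h : R, limn (fun N => N%:R^-1 * H N) = h by eexists.
have nR : 0 < n%:R :> R by rewrite ltr0n.
have hh : shannon p / n%:R <= h.
  apply/ler_addgt0Pr => e e0.
  have e2 : 0 < e / 2 by rewrite divr_gt0.
  have /cvgrPdist_le/(_ _ e2)[N0 _ hN0] := cvH; rewrite hE in hN0.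
  (* Only q of q + 1 blocks are counted; the deficit [shannon p] / (n (q + 1)) is at most e / 2 for
     this q. *)
  pose q := (N0 + Num.bound (shannon p / n%:R / (e / 2)))%N.
  have qN : (N0 <= n * q.+1)%N by rewrite /q; nia.
  have Nq : 0 < (n * q.+1)%:R :> R by rewrite ltr0n muln_gt0 n0.
  have := hN0 _ qN; rewrite ler_norml => /andP[lo _].
  have : q%:R * shannon p / (n * q.+1)%:R <= (n * q.+1)%:R^-1 * H (n * q.+1)%N.
    by rewrite mulrC ler_wpM2l ?invr_ge0 // Hq.
  rewrite /H in lo *; move: lo; set u := _^-1 * shannon (law mu _) => lo hu.
  have key : shannon p / n%:R - q%:R * shannon p / (n * q.+1)%:R <= e / 2.
    have -> : shannon p / n%:R - q%:R * shannon p / (n * q.+1)%:R =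
        shannon p / n%:R / q.+1%:R.
      by rewrite natrM -natr1; field; rewrite !gt_eqF //= natr1 ltr0n.
    rewrite ler_pdivrMr ?ltr0n // [leRHS]mulrC -ler_pdivrMr //.
    apply: ltW; apply: (lt_le_trans (unstable.ltr_bound _)).
    by rewrite ler_nat /q leqW // leq_addl.
  have aux (x u1 v h1 e1 : R) :
    - (e1 / 2) <= h1 - u1 -> v <= u1 -> x - v <= e1 / 2 -> x <= h1 + e1 by lra.
  exact: aux lo hu key.
have ks : (h%:E <= ks_entropy mu T)%E by rewrite -hE; exact: ks_entropy_ge.
have mphi : measurable_fun setT (phi : borel x0 -> R) by exact: continuous_measurable.
(* M - phi is nonnegative, so its integral makes sense at once; the integrability of phi then
   follows from the finiteness of that integral. *)
pose f (x : borel x0) := (M - phi x)%:E.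
have f0 x : (0 <= f x)%E by rewrite lee_fin subr_ge0.
have mf : measurable_fun setT f.
  by apply/measurable_EFinP; apply: measurable_funB.
pose J := (\sum_w p w * sphi n (xs w) - C) / n%:R.
have intf : (\int[mu]_x f x <= (M - J)%:E)%E.
  have F1 : measurable_fun setT (fun u => \sum_(i < n) f (g i u))%E.
    by apply: emeasurable_sum => i; exact: (measurableT_comp mf (mg i)).
  have F2 u : (0 <= \sum_(i < n) f (g i u))%E by exact: sume_ge0.
  have F3 : (0 <= n%:R^-1%:E :> \bar R)%E by rewrite lee_fin invr_ge0.
  rewrite mu_int // -ge0_integral_sum //; last first.
    by move=> i; exact: (measurableT_comp mf (mg i)).
  rewrite -(ge0_integralZl P measurableT F1 (fun u _ => F2 u) F3).
  have -> : M - J = \sum_w law P D w * (M - (sphi n (xs w) - C) / n%:R).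
    rewrite (law_bernoulli DG) /J.
    have e1 (b : R) : \sum_w p w * b = b by rewrite -mulr_suml p1 mul1r.
    rewrite [RHS](eq_bigr (fun w => p w * M - (p w * sphi n (xs w) - p w * C) / n%:R)).
      by rewrite sumrB e1 -[X in _ = _ - X]mulr_suml sumrB e1.
    by move=> w _; ring.
  rewrite -(integral_fin P (fun w => M - (sphi n (xs w) - C) / n%:R) mD).
  apply: ge0_le_integral => //.
  - by move=> u _; exact: mule_ge0.
  - exact: emeasurable_funM.
  - apply/measurable_EFinP.
    exact: (measurable_fin_comp (fun w => M - (sphi n (xs w) - C) / n%:R) mD).
  move=> u _; rewrite /f sumEFin -EFinM lee_fin sumrB sumr_const card_ord -/(sphi n (pi u)).
  rewrite -[M *+ n]mulr_natl mulrBr mulKf ?gt_eqF // lerD2l lerN2.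
  rewrite [leRHS]mulrC ler_wpM2r ?invr_ge0 //.
  (* The point and the loop of its first block agree also at coordinate n, where both are in state
     a. *)
  have : `|sphi n (pi u) - sphi n (xs (D u))| <= C.
    apply: distC => i; rewrite leq_eqVlt => /orP[/eqP ->|ni].
      have := block u 1%N 0%N n0; rewrite mul1n addn0 => ->.
      by rewrite (xl _).2 (loop_coord (xl _)).
    by have := block u 0%N i ni; rewrite mul0n add0n.
  rewrite ler_norml => /andP[? _]; lra.
have int_f0 : (0 <= \int[mu]_x f x)%E by exact: integral_ge0.
have int_phi : (J%:E <= \int[mu]_x (phi x)%:E)%E /\ (\int[mu]_x (phi x)%:E)%E \is a fin_num.
  have finf : mu.-integrable setT f.
    apply/integrableP; split => //.
    under eq_integral do rewrite gee0_abs //.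
    by apply: le_lt_trans intf _; rewrite ltry.
  have finM : mu.-integrable setT (EFin \o cst M) by exact: finite_measure_integrable_cst.
  have -> : (\int[mu]_x (phi x)%:E = M%:E - \int[mu]_x f x)%E.
    transitivity (\int[mu]_x ((EFin \o cst M) x - f x))%E.
      by apply: eq_integral => x _; rewrite /f /= -EFinB opprB addrC subrK.
    rewrite integralB //; congr (_ - _)%E.
    have -> : (\int[mu]_x (EFin \o cst M) x = \int[mu]_x cst M%:E x)%E by [].
    rewrite integral_cst //; transitivity (M%:E * 1)%E; last by rewrite mule1.
    by congr (_ * _)%E; exact: (probability_setT mu).
  have fin : (\int[mu]_x f x)%E \is a fin_num by exact: integrable_fin_num.
  rewrite -(fineK fin) in intf *; split; last by [].
  by move: intf; rewrite -EFinB !lee_fin; lra.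
exists (ks_entropy mu T + \int[mu]_x (phi x)%:E)%E.
  exists x0, mu; split => //; by rewrite fin_num_adde_defl // int_phi.2.
apply: (@le_trans _ _ (h%:E + J%:E)%E); last by apply: leeD => //; exact: int_phi.1.
rewrite -EFinD lee_fin; apply: le_trans (lerD hh (lexx J)).
(* h + J is at least (ln Z - C) / n, and this exceeds r because ln Z > n r + 2C and C >= 0. *)
rewrite /J -mulrDl ler_pdivlMr // Hp.
have : n%:R * r + 2 * C < ln Z by rewrite -ltr_expR lnK ?posrE // -ZE.
lra.
Qed.

End lower.

(** * The variational principle *)

Lemma lee_lower_cut (R : realType) (x y : \bar R) :
  (forall r : R, (r%:E < x)%E -> (r%:E <= y)%E) -> (x <= y)%E.
Proof.
move=> h; rewrite leNgt; apply/negP; case: y h => [y||] h yx.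
- have [r yr /h] := lt_EFin_dense yx; rewrite lee_fin; lra.
- by move: yx; rewrite ltNge leey.
- by have [r /h] := gtNy_EFin yx.
Qed.

Theorem theorem4p2 (R : realType) (S : countType) (A : rel S)
    (mixA : topologically_mixing A) (phi : tms A -> R) (phiW : walters phi)
    (phi_sup : (ereal_sup (range (fun x => (phi x)%:E)) < +oo)%E) (a : S) :
  gurevich_pressure phi a = ereal_sup (free_energies phi).
Proof.
have [N /(_ N (leqnn N))[x _]] := mixing_point mixA a a.
have [C _ distC] := walters_distortion x phiW.
have phi_cont : continuous phi by case: phiW.
have [M phiM] : exists M, forall x, phi x <= M.
  have ub y : ((phi y)%:E <= ereal_sup (range (fun x => (phi x)%:E)))%E.
    by apply: ereal_sup_ubound; exists y.
  case: ereal_sup phi_sup ub => [M||] // _ ub; last by have := ub x.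
  by exists M => y; rewrite -lee_fin.
apply/eqP; rewrite eq_le; apply/andP; split.
  apply: lee_lower_cut => r /(pressure_gt distC mixA)[n [s [n0 us sl hs]]].
  have [e fe re] := lower_bound distC phi_cont phiM n0 us sl hs.
  by apply: le_trans re _; exact: ereal_sup_ubound.
apply: ge_ereal_sup => e [x0 [mu]] /=; set h := ks_entropy _ _; set I := integral _ _ _.
move=> [mu_inv hI ->].
have mphi : measurable_fun setT (phi : borel x0 -> R) by exact: continuous_measurable.
have mT : measurable_fun setT (@tms_shift S A : borel x0 -> borel x0).
  exact: measurable_shift.
have [gN _] := pressure_cvg a distC mixA.
case PE : (gurevich_pressure phi a) gN => [P||] // _; last by rewrite leey.
(* P may exceed the supremum of phi, while [entropy_upper] asks for a bound of phi that is at least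
   P. *)
have PM : P <= Num.max M P by rewrite le_max lexx orbT.
have phiM' y : phi y <= Num.max M P by rewrite le_max phiM.
have [finI|nfinI] := boolP (I \is a fin_num).
  have phi_int : mu.-integrable setT (fun x => (phi x)%:E).
    apply/integrableP; split; first exact/measurable_EFinP.
    by rewrite integral_fin_num_abs.
  rewrite -leeBrDr // -(fineK finI) -EFinB.
  apply: ks_entropy_le => k Y mY; rewrite lee_fin.
  exact: (entropy_upper distC mixA PE phiM' PM mu_inv phi_int).
(* As phi is bounded above, an integral that is not finite equals -oo, and so does the free
   energy. *)
have I_lt : (I < +oo)%E.
  rewrite /I integralE.
  have neg0 : (0 <= \int[mu]_x (fun x => (phi x)%:E)^\- x)%E by exact: integral_ge0.
  apply: (@le_lt_trans _ _ (\int[mu]_x (fun x => (phi x)%:E)^\+ x)%E).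
    by rewrite -[leRHS]sube0; exact: leeB.
  apply: (@le_lt_trans _ _ (\int[mu]_x cst `|M|%:E x)%E).
    apply: ge0_le_integral => //.
      by apply: measurable_funepos; exact/measurable_EFinP.
    move=> y _; rewrite funeposE /= -EFin_max lee_fin ge_max normr_ge0 andbT.
    by apply: le_trans (phiM y) _; exact: ler_norm.
  by rewrite integral_cst // lte_mul_pinfty // ltey_eq fin_num_measure.
move: nfinI I_lt hI; case: I => [r||] //= _ _.
by rewrite addeNy leNye.
Qed.
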